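(* Let $B=(B_t)_{t\ge 0}$ be a real-valued standard Brownian motion with $B_0=0$. For $\gamma\in[0,\tfrac12]$ let $$E_\gamma=\{t\ge 0: |B_t|\le t^{\gamma}\}.$$ Almost surely, for all $\gamma\in[0,\tfrac12]$, $$\mathrm{Dim}_\mathrm{H} E_\gamma=\begin{cases}\tfrac12 & \text{if } \gamma\in[0,\tfrac12),\\ 1 & \text{if } \gamma=\tfrac12,\end{cases}$$ and $$\mathrm{Dim}_\mathrm{UM} E_\gamma=\mathrm{Den}_{\log} E_\gamma=\tfrac12+\gamma .$$
   Context: Notation: $|A|$ is Lebesgue measure. Let $\mathcal S_0=[0,1)$ and $\mathcal S_n=[2^{n-1},2^n)$ for $n\ge1$. For $E\subset\mathbb R^+$, $\rho\ge0$ and $n\ge1$, let $$\nu^n_\rho(E)=\inf\Big\{\sum_{i=1}^m\Big(\frac{|Q_i|}{2^n}\Big)^\rho: Q_i\subset\mathcal S_n \text{ non-trivial intervals with integer endpoints},\ E\cap\mathcal S_n\subset\bigcup_{i=1}^m Q_i\Big\},$$ the infimum being over finite families. The macroscopic Hausdorff dimension is $\mathrm{Dim}_\mathrm{H}E=\inf\{\rho\ge0:\sum_{n\ge1}\nu^n_\rho(E)<\infty\}$. For $E\subset\mathbb R^+$, $\mathrm{pix}(E)=\{x\in\mathbb Z:\mathrm{dist}(x,E)\le1\}$; the upper mass dimension is $\mathrm{Dim}_\mathrm{UM}E=\limsup_{n\to\infty}\frac{\log_2\sharp\,\mathrm{pix}(E\cap[0,2^n])}{n}$, and the logarithmic density is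 $\mathrm{Den}_{\log}E=\limsup_{n\to\infty}\frac{\log_2|E\cap[0,2^n]|}{n}$. *)

(* Defs.v *)
From HB Require Import structures.
From mathcomp Require Import all_boot all_order all_algebra.
From mathcomp Require Import all_classical all_reals all_analysis.
Set Implicit Arguments. Unset Strict Implicit. Unset Printing Implicit Defensive.
Import Order.TTheory GRing.Theory Num.Theory.
Import numFieldNormedType.Exports.
Local Open Scope classical_set_scope.
Local Open Scope ring_scope.

(* B t w is the position at time t >= 0 of the path w; values at t < 0 are
   irrelevant. Standard BM: B_0 = 0 and continuous paths a.s., each B_t
   measurable, increments B_t - B_s (0 <= s < t) are N(0, t - s)
   (normal_prob takes mean and standard deviation), and increments over
   consecutive disjoint intervals are mutually independent. *)
Definition brownian_motion d (T : measurableType d) (R : realType)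
    (P : probability T R) (B : R -> T -> R) : Prop :=
  [/\ (forall t, 0 <= t -> measurable_fun setT (B t)),
      {ae P, forall w, B 0 w = 0 /\
                       {within `[0, +oo[, continuous (fun t => B t w)}},
      (forall s t, 0 <= s -> s < t -> forall A : set R, measurable A ->
         P ((fun w => B t w - B s w) @^-1` A)
         = normal_prob 0 (Num.sqrt (t - s)) A) &
      (forall (n : nat) (t : nat -> R), 0 <= t 0%N ->
         (forall i, (i < n)%N -> t i < t i.+1) ->
         forall A : nat -> set R, (forall i, measurable (A i)) ->
         P (\bigcap_(i in `I_n) ((fun w => B (t i.+1) w - B (t i) w) @^-1` A i))
         = (\prod_(i < n) P ((fun w => (B (t i.+1) w - B (t i) w)%R) @^-1` A i))%E)].

Definition Egam (R : realType) (T : Type) (B : R -> T -> R) (w : T) (g : R)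
  : set R := [set t | 0 <= t /\ `|B t w| <= t `^ g].

Definition Sn (R : realType) (n : nat) : set R :=
  [set x | (2 ^+ n.-1)%:R <= x /\ x < 2 ^+ n].

Definition nu (R : realType) (n : nat) (rho : R) (E : set R) : R :=
  inf [set s : R | exists Q : seq (nat * nat),
         (forall q, q \in Q -> (2 ^ n.-1 <= q.1)%N /\ (q.1 < q.2)%N
                               /\ (q.2 <= 2 ^ n)%N) /\
         (E `&` @Sn R n `<=` \bigcup_(q in [set q | q \in Q])
                               `[(q.1)%:R, (q.2)%:R[%classic) /\
         s = \sum_(q <- Q) (((q.2 - q.1)%:R / 2 ^+ n) `^ rho)].

Definition DimH (R : realType) (E : set R) : \bar R :=
  ereal_inf [set rho%:E | rho in
     [set rho : R | 0 <= rho /\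
        (\sum_(1 <= n <oo) (nu n rho E)%:E < +oo)%E]].

Definition log2e (R : realType) (x : \bar R) : \bar R :=
  match x with
  | r%:E => if r == 0 then -oo%E else (ln r / ln 2)%:E
  | y => y
  end.

(* pix(E) = { x in Z : dist(x, E) <= 1 } (dist to the empty set = +oo) *)
Definition pix (R : realType) (E : set R) : set int :=
  [set x : int | forall e : R, 0 < e -> exists y, E y /\ `|x%:~R - y| < 1 + e].

Definition ecard (R : realType) (S : set int) : \bar R :=
  (\esum_(x in S) (1 : \bar R))%E.

Definition DimUM (R : realType) (E : set R) : \bar R :=
  limn_esup (fun n : nat =>
    (log2e (@ecard R (pix (E `&` `[0%R, (2 ^+ n)%R]%classic))) * (n%:R^-1)%:E)%E).

Definition Denlog (R : realType) (E : set R) : \bar R :=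
  limn_esup (fun n : nat =>
    (log2e (lebesgue_measure (E `&` `[0%R, (2 ^+ n)%R]%classic)) * (n%:R^-1)%:E)%E).

(* Main.v *)
Require Import Defs.
From HB Require Import structures.
From mathcomp Require Import all_boot all_order all_algebra.
From mathcomp Require Import all_classical all_reals all_analysis.
From mathcomp Require Import measurable_realfun zify ring lra.
Set Implicit Arguments.
Unset Strict Implicit.
Unset Printing Implicit Defensive.
Import Order.TTheory GRing.Theory Num.Theory.
Import numFieldNormedType.Exports.
Local Open Scope classical_set_scope.
Local Open Scope ring_scope.

(** Write W t = B t - B 0 and count the grid points at which W is small.

    Upper bounds. By chaining, almost surely W moves by at most a linear factor
    times 2^(m/2) on every dyadic cell of length 2^m in [0, 2^n]; so a cell met
    by E_g has its left end point in {|W| <= O(n) 2^(n g)} as soon as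
    m <= 2 g n.  The expected number of such cells is O(n) 2^(n/2 + n g - m), and
    Markov's inequality with Borel-Cantelli turns this into an almost sure
    bound, up to 2^(e n).  With m = 0 this bounds the mass and the pixels, with
    m = 2 g n it gives summable covers for every exponent above 1/2.

    Lower bounds. The number X_m of integers i of [2^m, 2^(m+1)) with
    |W i| <= a_m, divided by its expected value, has bounded variance and is
    asymptotically uncorrelated over well separated scales, so by Chebyshev
    its average over many scales is rarely below 1/2; hence X_m is almost surely
    of the order of its mean infinitely often.  This gives the mass, the pixels
    and the dimension at g = 1/2.  For g < 1/2 the same averages of X_m are
    compared with Riesz energies: X <= s nu / 2 + energy / (2 s). *)

(** The statement is for all g at once, so almost sure facts are collected for countably many
    rational exponents only, and a real g is then treated on a fixed path by comparison with nearby
    rationals. The lower bounds rest on one- and two-time estimates for W, without a zero-one law.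
    For fixed parameters Chebyshev bounds the probability of few visits uniformly in the starting
    scale, but by a quantity that does not tend to 0, so Borel-Cantelli is out of reach. Instead the
    parameters are retuned for every eta: a set that lies, for each eta, in the liminf of events of
    probability at most eta is negligible. The constants obtained this way depend on the path. Since
    covers depend on the path as well, the energy comparison is stated for an arbitrary sequence in
    the role of the covering numbers, which keeps the choice of covers out of the probabilistic
    part. *)

(** * Finite sums of indicators, Borel-Cantelli and a liminf criterion *)

Section probability_tools.
Context {R : realType} {d : measure_display} {T : measurableType d}.
Variable P : probability T R.

Definition pr (A : set T) : R := fine (P A).

Lemma prE A : measurable A -> P A = (pr A)%:E.
Proof. by move=> mA; rewrite /pr fineK// fin_num_measure. Qed.

Lemma pr_ge0 A : 0 <= pr A.
Proof. by rewrite /pr fine_ge0. Qed.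

Section weighted_sums.
Variable I : Type.
Implicit Types (s : seq I) (v : I -> R) (A : I -> set T).

Definition wsum s v A (x : T) : R := \sum_(i <- s) v i * \1_(A i) x.

Lemma wsum_ge0 s v A x : (forall i, 0 <= v i) -> 0 <= wsum s v A x.
Proof. by move=> v0; apply: sumr_ge0 => i _; rewrite mulr_ge0// indicE ler0n. Qed.

Lemma measurable_wsum s v A : (forall i, measurable (A i)) ->
  measurable_fun setT (wsum s v A).
Proof.
move=> mA; rewrite /wsum; elim: s => [|i s ih].
  by under eq_fun do rewrite big_nil; exact: measurable_cst.
under eq_fun do rewrite big_cons.
apply: measurable_funD => //; apply: measurable_funM; first exact: measurable_cst.
exact: measurable_indic.
Qed.

Lemma integral_wsum s v A : (forall i, 0 <= v i) ->
  (forall i, measurable (A i)) ->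
  (\int[P]_x (wsum s v A x)%:E)%E = (\sum_(i <- s) v i * pr (A i))%:E.
Proof.
move=> v0 mA.
have -> : (fun x => (wsum s v A x)%:E) =
    (fun x => \sum_(i <- s) ((v i)%:E * (\1_(A i) x)%:E))%E.
  by apply/funext => x; rewrite /wsum -sumEFin; apply: eq_bigr => i _.
rewrite ge0_integral_sum//.
- rewrite -sumEFin; apply: eq_bigr => i _.
  rewrite ge0_integralZl_EFin//.
  + by rewrite integral_indic// setIT EFinM; congr (_ * _)%E; exact: prE.
  + by apply/measurable_EFinP; exact: measurable_indic.
- move=> i; apply: measurable_funeM; apply/measurable_EFinP.
  exact: measurable_indic.
- by move=> i x _; rewrite lee_fin mulr_ge0// indicE ler0n.
Qed.

End weighted_sums.

(** Integrates a pointwise comparison: Markov's inequality, Chebyshev's inequality and the union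
    bound are all instances, with suitable weights and events. *)
Lemma wsum_le (I J : Type) (s : seq I) (v : I -> R) (A : I -> set T)
    (s' : seq J) (v' : J -> R) (A' : J -> set T) :
  (forall i, 0 <= v i) -> (forall i, measurable (A i)) ->
  (forall i, 0 <= v' i) -> (forall i, measurable (A' i)) ->
  (forall x, wsum s v A x <= wsum s' v' A' x) ->
  \sum_(i <- s) v i * pr (A i) <= \sum_(i <- s') v' i * pr (A' i).
Proof.
move=> v0 mA v'0 mA' le.
rewrite -lee_fin -!integral_wsum//.
apply: ge0_le_integral => //.
all: first [by apply/measurable_EFinP; exact: measurable_wsum
           |by move=> x _; rewrite lee_fin ?wsum_ge0].
Qed.

Lemma wsum_measurable_le (I : Type) (s : seq I) (v : I -> R)
    (A : I -> set T) (c : R) :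
  (forall i, measurable (A i)) -> measurable [set x | wsum s v A x <= c].
Proof.
move=> mA; rewrite -[X in measurable X]setTI.
by apply: measurable_fun_le; [| exact: measurable_wsum | exact: measurable_cst].
Qed.

Lemma wsum_measurable_ge (I : Type) (s : seq I) (v : I -> R)
    (A : I -> set T) (c : R) :
  (forall i, measurable (A i)) -> measurable [set x | c <= wsum s v A x].
Proof.
move=> mA; rewrite -[X in measurable X]setTI.
by apply: measurable_fun_le; [| exact: measurable_cst | exact: measurable_wsum].
Qed.

Lemma markov_wsum (I : Type) (s : seq I) (v : I -> R) (A : I -> set T)
    (c : R) :
  (forall i, 0 <= v i) -> (forall i, measurable (A i)) ->
  0 <= c ->
  c * pr [set x | c <= wsum s v A x] <= \sum_(i <- s) v i * pr (A i).
Proof.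
move=> v0 mA c0.
have mH : measurable [set x | c <= wsum s v A x] by exact: wsum_measurable_ge.
have := @wsum_le unit I [:: tt] (fun=> c) (fun=> [set x | c <= wsum s v A x])
  s v A (fun=> c0) (fun=> mH) v0 mA.
rewrite big_seq1; apply => x.
rewrite [X in X <= _]/wsum big_seq1 indicE.
have [/set_mem h|h] := boolP (x \in _); last by rewrite mulr0 wsum_ge0.
by rewrite mulr1.
Qed.

(* Lower-tail Chebyshev inequality, in a form with both sides nonnegative:
   [K^2/4 1_H + 2 K S <= S^2 + K^2] pointwise, where [H] is [S <= K/2]. *)
Lemma chebyshev_wsum (I : Type) (s : seq I) (v : I -> R) (A : I -> set T)
    (K : R) :
  (forall i, 0 <= v i) -> (forall i, measurable (A i)) -> 0 <= K ->
  K ^+ 2 / 4 * pr [set x | wsum s v A x <= K / 2] +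
    2 * K * (\sum_(i <- s) v i * pr (A i)) <=
  \sum_(i <- s) \sum_(j <- s) v i * v j * pr (A i `&` A j) + K ^+ 2.
Proof.
move=> v0 mA K0; set H := [set x | _].
have mH : measurable H by exact: wsum_measurable_le.
(* [None] carries the extra term of each side: the event [H] on the left, the constant K^2 on the
   right. *)
pose A1 (o : option I) := if o is Some i then A i else H.
pose v1 (o : option I) := if o is Some i then 2 * K * v i else K ^+ 2 / 4.
pose A2 (o : option (I * I)) := if o is Some p then A p.1 `&` A p.2 else setT.
pose v2 (o : option (I * I)) := if o is Some p then v p.1 * v p.2 else K ^+ 2.
set l1 := None :: map Some s; set l2 := None :: map Some (allpairs pair s s).
have e1 : \sum_(o <- l1) v1 o * pr (A1 o) =
    K ^+ 2 / 4 * pr H + 2 * K * (\sum_(i <- s) v i * pr (A i)).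
  rewrite big_cons big_map /= mulr_sumr; congr (_ + _).
  by apply: eq_bigr => i _; rewrite mulrA.
have e2 : \sum_(o <- l2) v2 o * pr (A2 o) =
    \sum_(i <- s) \sum_(j <- s) v i * v j * pr (A i `&` A j) + K ^+ 2.
  rewrite big_cons big_map big_allpairs /= [RHS]addrC; congr (_ + _).
  by rewrite /pr probability_setT mulr1.
rewrite -e1 -e2; apply: wsum_le.
- by case => [i|] /=; rewrite ?mulr_ge0// divr_ge0// sqr_ge0.
- by case.
- by case => [p|] /=; rewrite ?mulr_ge0// sqr_ge0.
- by case => [p|] //=; exact: measurableI.
move=> x; rewrite /wsum !big_cons !big_map /= big_allpairs /=.
have -> : \sum_(i <- s) \sum_(j <- s) v i * v j * \1_(A i `&` A j) x =
    wsum s v A x ^+ 2.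
  rewrite expr2 /wsum mulr_suml; apply: eq_bigr => i _.
  rewrite mulr_sumr; apply: eq_bigr => j _.
  by rewrite indicI /=; ring.
have -> : \sum_(j <- s) 2 * K * v j * \1_(A j) x = 2 * K * wsum s v A x.
  by rewrite /wsum mulr_sumr; apply: eq_bigr => j _; rewrite mulrA.
rewrite indicT/= mulr1 indicE.
have S0 := wsum_ge0 s A x v0.
set S := wsum _ _ _ _ in S0 *.
have [/set_mem|_] := boolP (x \in H); rewrite /= ?mulr1 ?mulr0; last first.
  by have := sqr_ge0 (K - S); nra.
(* Expanded, this product is S^2 - 2 K S + 3 K^2 / 4, exactly the gap to be shown nonnegative. *)
rewrite /H /= -/S => SK; have : 0 <= (K / 2 - S) * (K / 2 - S + K) by apply: mulr_ge0; lra.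
by nra.
Qed.

Lemma borel_cantelli_geometric (A : nat -> set T) (C q : R) :
  (forall n, measurable (A n)) -> 0 <= q -> q < 1 ->
  (forall n, pr (A n) <= C * q ^+ n) ->
  {ae P, forall x, exists N, forall n, (N <= n)%N -> ~ A n x}.
Proof.
move=> mA q0 q1 le.
have C0 : 0 <= C by have := le 0%N; rewrite expr0 mulr1; apply: le_trans (pr_ge0 _).
have P0 : P (lim_sup_set A) = 0%E.
  apply: lim_sup_set_cvg0 => //.
  apply: (@le_lt_trans _ _ (\sum_(n <oo) (geometric C q n)%:E)%E).
    by apply: lee_nneseries => // n _; have := le n; rewrite -lee_fin -prE.
  have /cvg_geometric_series cv : `|q| < 1 by rewrite ger0_norm.
  have /cvg_lim h := cv C.
  have -> : (\sum_(n <oo) (geometric C q n)%:E)%E = (C / (1 - q))%:E.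
    apply/cvg_lim => //.
    rewrite (_ : (fun n => _) = EFin \o series (geometric C q)).
      by apply: cvg_EFin; [exact: nearW|exact: cv].
    by apply/funext => n /=; rewrite sumEFin.
  by rewrite ltry.
exists (lim_sup_set A); split => //.
  apply: bigcapT_measurable => n; apply: bigcup_measurable => *; exact: mA.
move=> x /= nx n _; apply: contrapT => h; apply: nx; exists n => m nm Am.
by apply: h; exists m.
Qed.

(** The intersections over n >= N increase with N to the liminf, whose measure is therefore at most
    eta; [H] may change with eta. This replaces Borel-Cantelli when the probabilities are small but
    not summable. *)
Lemma negligible_of_liminf (E : set T) :
  (forall eta : R, 0 < eta -> exists (H : nat -> set T) (N0 : nat),
     [/\ forall n, measurable (H n),
         forall n, (N0 <= n)%N -> pr (H n) <= eta &
         E `<=` \bigcup_N \bigcap_(n in [set n | (N <= n)%N]) H n]) ->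
  P.-negligible E.
Proof.
move=> h.
have /choice[F hF] : forall k : nat, exists F : set T,
    [/\ measurable F, (P F <= (k.+1%:R^-1)%:E)%E & E `<=` F].
  move=> k; have [|H [N0 [mH leH EH]]] := h (k.+1%:R^-1); first by rewrite invr_gt0.
  pose G N := \bigcap_(n in [set n | (N <= n)%N]) H n.
  have mG N : measurable (G N).
    by apply: bigcap_measurableType => n _; exact: mH.
  have mU : measurable (\bigcup_N G N) by apply: bigcupT_measurable.
  exists (\bigcup_N G N); split => //.
  have ndG : nondecreasing_seq G.
    by move=> a b ab; apply/subsetPset => x Gx n /= bn; apply: Gx => /=; exact: leq_trans bn.
  have cv := @nondecreasing_cvg_mu _ _ _ P G mG mU ndG.
  rewrite -(cvg_lim _ cv)//; apply: lime_le; first by apply/cvg_ex; eexists; exact: cv.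
  exists N0 => // n /= N0n.
  apply: le_trans (_ : (P (H n) <= _)%E).
    by apply: le_measure; rewrite ?inE// => x; apply => /=.
  by have := leH n N0n; rewrite -lee_fin -prE.
exists (\bigcap_k F k); split.
- by apply: bigcapT_measurable => k; have [] := hF k.
- apply/eqP; rewrite eq_le measure_ge0 andbT.
  apply/lee_addgt0Pr => e e0; rewrite add0e.
  have [k kP] : exists k : nat, k.+1%:R^-1 <= e.
    exists (Num.truncn e^-1); rewrite invf_ple ?posrE//.
    by rewrite ltW// truncnS_gt.
  have [mF lF _] := hF k.
  apply: le_trans (_ : (P (F k) <= _)%E).
    apply: le_measure; rewrite ?inE//; last by move=> x; apply.
    by apply: bigcapT_measurable => j; have [] := hF j.
  by apply: le_trans lF _; rewrite lee_fin.
- by move=> x Ex k _; have [_ _] := hF k; apply.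
Qed.

End probability_tools.

(** * Gaussian density and tail bounds *)

Section normal_estimates.
Context {R : realType}.
Implicit Types a x y s : R.
Let mu := @lebesgue_measure R.

(** The maximum of the standard normal density; that of N(0, s^2) peaks at [c0 / s]. *)
Definition c0 : R := (Num.sqrt (pi *+ 2))^-1.

Lemma c0_gt0 : 0 < c0.
Proof. by rewrite invr_gt0 sqrtr_gt0 pmulrn_rgt0// pi_gt0. Qed.

Lemma c0_le1 : c0 <= 1.
Proof.
have h : 1 <= Num.sqrt (pi *+ 2) :> R.
  rewrite -[leLHS]sqrtr1 ler_wsqrtr//.
  by have := @pi_ge2 R; rewrite -mulr_natr; lra.
by rewrite /c0 invf_le1// (lt_le_trans _ h).
Qed.

Lemma normal_peakE s : 0 < s -> normal_peak s = c0 / s.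
Proof.
move=> s0; rewrite /normal_peak /c0 -mulrnAr sqrtrM ?sqr_ge0//.
by rewrite sqrtr_sqr gtr0_norm// invfM mulrC.
Qed.

Lemma normal_pdf0E s x : 0 < s ->
  normal_pdf 0 s x = c0 / s * expR (- (x ^+ 2 / (2 * s ^+ 2))).
Proof.
move=> s0; rewrite normal_pdfE ?gt_eqF// normal_peakE// /normal_fun subr0.
by congr (_ * expR _); rewrite mulNr -mulr_natl.
Qed.

Lemma fine_normal_probE s (A : set R) : measurable A ->
  (fine (normal_prob 0 s A))%:E = (\int[mu]_(x in A) (normal_pdf 0 s x)%:E)%E.
Proof. by move=> mA; rewrite fineK// fin_num_measure. Qed.

Let measurable_pdf s (A : set R) :
  measurable_fun A (fun x => (normal_pdf 0 s x)%:E).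
Proof.
by apply/measurable_funTS/measurable_EFinP; exact: measurable_normal_pdf.
Qed.

Let integral_itv_cst x y (k : R) : x <= y ->
  (\int[mu]_(z in `[x, y]) k%:E)%E = (k * (y - x))%:E.
Proof.
move=> xy; rewrite integral_cst//= EFinM; congr (_ * _)%E.
rewrite lebesgue_measure_itv/= lte_fin; move: xy; rewrite le_eqVlt => /predU1P[->|xy].
  by rewrite ltxx subrr.
by rewrite xy EFinB.
Qed.

Lemma normal_itv_le s x y : 0 < s -> x <= y ->
  fine (normal_prob 0 s `[x, y]) <= c0 / s * (y - x).
Proof.
move=> s0 xy; rewrite -lee_fin fine_normal_probE// -integral_itv_cst//.
apply: ge0_le_integral => //.
- by move=> z _; rewrite lee_fin normal_pdf_ge0.
- exact: measurable_pdf.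
- by move=> z _; rewrite lee_fin -normal_peakE// normal_pdf_ub// gt_eqF.
Qed.

(** On [-a, a] the density is at least its peak times 1 - a^2 / (2 s^2), by exp(-u) >= 1 - u. *)
Lemma normal_itv_ge s a : 0 < s -> 0 <= a ->
  c0 / s * (2 * a) * (1 - a ^+ 2 / (2 * s ^+ 2)) <=
  fine (normal_prob 0 s `[- a, a]).
Proof.
move=> s0 a0; rewrite -lee_fin fine_normal_probE//.
have -> : c0 / s * (2 * a) * (1 - a ^+ 2 / (2 * s ^+ 2)) =
    (c0 / s * (1 - a ^+ 2 / (2 * s ^+ 2))) * (a - - a) by ring.
have aa : - a <= a by lra.
rewrite -integral_itv_cst//.
(* A negative correction factor makes the bound trivial; otherwise the constant minorant is
   nonnegative and can be integrated. *)
have [h|h] := leP 0 (1 - a ^+ 2 / (2 * s ^+ 2)); last first.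
  rewrite integral_itv_cst//.
  apply: (@le_trans _ _ 0%E).
    rewrite lee_fin -mulrA -mulrA mulr_ge0_le0 ?(ltW c0_gt0)//.
    rewrite mulr_ge0_le0 ?invr_ge0 ?(ltW s0)//.
    by apply: mulr_le0_ge0; lra.
  by apply: integral_ge0 => z _; rewrite lee_fin normal_pdf_ge0.
have c0s : 0 <= c0 / s by rewrite mulr_ge0 ?invr_ge0 ?(ltW s0) ?(ltW c0_gt0).
apply: ge0_le_integral => //.
- by move=> z _; rewrite lee_fin mulr_ge0.
- exact: measurable_pdf.
move=> z /=; rewrite in_itv/= => /andP[az za].
rewrite lee_fin normal_pdf0E// ler_wpM2l//.
apply: le_trans (expR_ge1Dx _); rewrite lerD2l lerN2.
rewrite ler_wpM2r ?invr_ge0 ?mulr_ge0 ?(ltW s0) ?sqr_ge0//.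
have : 0 <= (a - z) * (a + z) by apply: mulr_ge0; lra.
by nra.
Qed.
Lemma measurable_gt_norm x : measurable [set y : R | x < `|y| ].
Proof.
have -> : [set y : R | x < `|y|] = ~` (setT `&` [set y | `|y| <= x]).
  rewrite setTI; apply/seteqP; split => y /=.
    by move=> h /(lt_le_trans h); rewrite ltxx.
  by move/negP; rewrite -ltNge.
by apply: measurableC; apply: measurable_fun_le.
Qed.

(** Doubling the variance avoids computing a tail integral: with u = x^2 / (4 s^2) the density is
    sqrt 2 exp(-u) times that of N(0, 2 s^2), whose total mass is 1. On the tail u >= k^2 >= 2 k -
    1, so exp(-u) <= e exp(-2 k) <= 4 / 4^k; the constant 8 also absorbs sqrt 2. *)
Lemma normal_tail s (k : nat) : 0 < s ->
  fine (normal_prob 0 s [set x | 2 * k%:R * s < `|x| ]) <= 8 * 4^-1 ^+ k.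
Proof.
move=> s0; set A := [set x | _].
have mA : measurable A by exact: measurable_gt_norm.
pose s' := Num.sqrt 2 * s.
have s'0 : 0 < s' by rewrite mulr_gt0.
have sq2 : (Num.sqrt 2 : R) ^+ 2 = 2 by rewrite sqr_sqrtr.
pose C : R := 8 * 4^-1 ^+ k.
have C0 : 0 <= C by rewrite mulr_ge0// exprn_ge0.
have key x : A x -> normal_pdf 0 s x <= C * normal_pdf 0 s' x.
  rewrite /A/= => Ax.
  rewrite !normal_pdf0E// /s' exprMn sq2.
  set u := x ^+ 2 / (2 * (2 * s ^+ 2)).
  have -> : x ^+ 2 / (2 * s ^+ 2) = u + u by rewrite /u; field; rewrite gt_eqF.
  have uk : 2 * k%:R - 1 <= u.
    have h : k%:R ^+ 2 <= u.
      rewrite /u ler_pdivlMr ?mulr_gt0 ?exprn_gt0//.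
      rewrite -(real_normK (num_real x)).
      have -> : k%:R ^+ 2 * (2 * (2 * s ^+ 2)) = (2 * k%:R * s) ^+ 2 by ring.
      by rewrite lerXn2r ?nnegrE ?mulr_ge0 ?(ltW s0)// ltW.
    by apply: le_trans h; have := sqr_ge0 (k%:R - 1 : R); nra.
  have e2 : 4 <= expR 2 :> R.
    have -> : 2 = 1 + 1 :> R by ring.
    by rewrite expRD; have := expR_ge1Dx (1 : R); nra.
  have e1 : expR 1 <= 4 :> R.
    have h : 2^-1 <= expR (- 2^-1) :> R by have := expR_ge1Dx (- 2^-1 : R); lra.
    have e0 := expR_gt0 (2^-1 : R).
    have h1 : expR (2^-1) <= 2 :> R.
      have : expR (2^-1) * expR (- 2^-1) = 1 :> R by rewrite -expRD subrr expR0.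
      by nra.
    have -> : 1 = 2^-1 + 2^-1 :> R by field.
    by rewrite expRD; nra.
  have eu : expR (- u) <= 4 * 4^-1 ^+ k.
    apply: (@le_trans _ _ (expR (1 - 2 * k%:R))); first by rewrite ler_expR; lra.
    rewrite expRD ler_pM ?expR_ge0//.
    rewrite expRN exprVn lef_pV2 ?posrE ?expR_gt0 ?exprn_gt0//.
    by rewrite mulrC expRM_natl lerXn2r ?nnegrE ?expR_ge0.
  have r2 : Num.sqrt 2 <= 2 :> R.
    by have := sqrtr_ge0 (2 : R); nra.
  have r20 : 0 < Num.sqrt 2 :> R by rewrite sqrtr_gt0.
  have E0 := expR_ge0 (- u).
  rewrite opprD expRD.
  have -> : C * (c0 / (Num.sqrt 2 * s) * expR (- u)) =
    (c0 / s * expR (- u)) * (C / Num.sqrt 2) by field; rewrite !gt_eqF.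
  rewrite mulrA ler_wpM2l ?mulr_ge0 ?invr_ge0 ?(ltW s0) ?(ltW c0_gt0)//.
  rewrite ler_pdivlMr//.
  apply: le_trans (_ : expR (- u) * 2 <= _); first by rewrite ler_wpM2l.
  by rewrite /C; lra.
rewrite -lee_fin fine_normal_probE//.
apply: (@le_trans _ _ (\int[mu]_(x in A) (C%:E * (normal_pdf 0 s' x)%:E))%E).
  apply: ge0_le_integral => //.
  - by move=> z _; rewrite lee_fin normal_pdf_ge0.
  - exact: measurable_pdf.
  - by apply: measurable_funeM; exact: measurable_pdf.
rewrite ge0_integralZl_EFin//; first last.
- exact: measurable_pdf.
- by move=> z _; rewrite lee_fin normal_pdf_ge0.
rewrite -[leRHS]mule1 lee_wpmul2l ?lee_fin//.
rewrite -(integral_normal_pdf 0 s') ge0_subset_integral//.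
- exact: measurable_pdf.
- by move=> z _; rewrite lee_fin normal_pdf_ge0.
Qed.

End normal_estimates.

Lemma pr_union_le {R : realType} {d : measure_display} {T : measurableType d}
    (P : probability T R) (I : eqType) (s : seq I) (A : set T) (F : I -> set T) :
  measurable A -> (forall i, measurable (F i)) ->
  (forall x, A x -> exists2 i, i \in s & F i x) ->
  pr P A <= \sum_(i <- s) pr P (F i).
Proof.
move=> mA mF cov.
have -> : pr P A = \sum_(i <- [:: tt]) 1 * pr P A by rewrite big_seq1 mul1r.
have -> : \sum_(i <- s) pr P (F i) = \sum_(i <- s) 1 * pr P (F i).
  by apply: eq_bigr => i _; rewrite mul1r.
apply: (@wsum_le _ _ _ P unit I [:: tt] (fun=> 1) (fun=> A)) => // x.
rewrite [X in X <= _]/wsum big_seq1 mul1r indicE.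
have [/set_mem Ax|_] := boolP (x \in A); last exact: wsum_ge0.
have [i si Fi] := cov _ Ax.
rewrite /wsum (big_rem i)//= mul1r indicE mem_set// lerDl.
by apply: sumr_ge0 => j _; rewrite mul1r indicE.
Qed.

Lemma exists_slice (R : realType) (K : nat) (x0 h x : R) :
  x0 <= x -> x <= x0 + K.+1%:R * h ->
  exists2 i, (i < K.+1)%N & x0 + i%:R * h <= x <= x0 + i.+1%:R * h.
Proof.
move=> x0x; elim: K => [|K ih] xK.
  by exists 0%N => //; rewrite mul0r addr0 x0x.
have [/ih[i iK ix]|Kx] := leP x (x0 + K.+1%:R * h).
  by exists i => //; exact: ltnW.
by exists K.+1 => //; rewrite xK ltW.
Qed.

(** * One- and two-time estimates for Brownian motion *)

Section brownian_motion_estimates.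
Context {R : realType} {d : measure_display} {T : measurableType d}.
Variables (P : probability T R) (B : R -> T -> R).
Hypothesis BM : brownian_motion P B.
Implicit Types s t a b : R.
Local Notation c0 := (@c0 R).

(** [B 0] vanishes only almost surely; subtracting it makes every value an increment, whose law is
    exactly normal. *)
Definition shiftedBM t w : R := B t w - B 0 w.
Local Notation W := shiftedBM.

Lemma measurable_W t : 0 <= t -> measurable_fun setT (W t).
Proof.
by have [mB _ _ _] := BM; move=> t0; apply: measurable_funB; exact: mB.
Qed.

Lemma pr_incr s t (A : set R) : 0 <= s -> s < t -> measurable A ->
  pr P [set w | A (W t w - W s w)] = fine (normal_prob 0 (Num.sqrt (t - s)) A).
Proof.
have [_ _ g _] := BM; move=> s0 st mA; rewrite -(g s t s0 st A mA) /pr.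
congr (fine (P _)); apply/seteqP; split => w /=;
  by rewrite /shiftedBM opprB addrA subrK.
Qed.

Lemma pr_W t (A : set R) : 0 < t -> measurable A ->
  pr P [set w | A (W t w)] = fine (normal_prob 0 (Num.sqrt t) A).
Proof.
move=> t0 mA; have := pr_incr (lexx 0) t0 mA; rewrite subr0 => <-.
by congr (pr P _); apply/seteqP; split => w /=; rewrite /shiftedBM subrr subr0.
Qed.

Lemma measurable_W_preimage t (A : set R) : 0 <= t -> measurable A ->
  measurable [set w | A (W t w)].
Proof.
by move=> t0 mA; rewrite -[X in measurable X]setTI; exact: measurable_W.
Qed.

Lemma measurable_W_incr s t (A : set R) : 0 <= s -> 0 <= t -> measurable A ->
  measurable [set w | A (W t w - W s w)].
Proof.
move=> s0 t0 mA; rewrite -[X in measurable X]setTI.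
by apply: (measurable_funB (measurable_W t0) (measurable_W s0)).
Qed.

Lemma pr_indep s t (A A' : set R) : 0 < s -> s < t ->
  measurable A -> measurable A' ->
  pr P ([set w | A (W s w)] `&` [set w | A' (W t w - W s w)]) =
  pr P [set w | A (W s w)] * pr P [set w | A' (W t w - W s w)].
Proof.
move=> s0 st mA mA'.
pose u (i : nat) : R := if i is 0%N then 0 else if i is 1%N then s else t.
pose C (i : nat) := if i is 0%N then A else A'.
have [_ _ _ /(_ 2%N u)] := BM.
have u2 i : (i < 2)%N -> u i < u i.+1 by case: i => [|[|//]].
have mC i : measurable (C i) by case: i.
move=> /(_ (lexx _) u2 C mC).
rewrite !big_ord_recl big_ord0 mule1 /u /C/=.
set E := \bigcap_(i in _) _.
have -> : [set w | A (W s w)] = (fun w => B s w - B 0 w) @^-1` A by [].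
have -> : [set w | A' (W t w - W s w)] = (fun w => B t w - B s w) @^-1` A'.
  by apply/seteqP; split => w /=; rewrite /shiftedBM opprB addrA subrK.
have -> : ((fun w => B s w - B 0 w) @^-1` A) `&`
   ((fun w => B t w - B s w) @^-1` A') = E.
  apply/seteqP; split => w /=.
    by case=> h1 h2 [|[|//]].
  by move=> h; split; [apply: (h 0%N)|apply: (h 1%N)].
move=> h; rewrite /pr h fineM//; rewrite fin_num_measure//.
- exact: (measurable_W_preimage (ltW s0)).
- have := measurable_W_incr (ltW s0) (ltW (lt_trans s0 st)) mA'.
  congr measurable; apply/seteqP; split => w /=;
  by rewrite /shiftedBM opprB addrA subrK.
Qed.

Definition absW a t := [set w | `|W t w| <= a].

Lemma absWE a t : absW a t = [set w | `[- a, a]%classic (W t w)].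
Proof. by apply/seteqP; split => w; rewrite /absW/= in_itv/= ler_norml. Qed.

Lemma measurable_absW a t : 0 <= t -> measurable (absW a t).
Proof. by move=> t0; rewrite absWE; exact: measurable_W_preimage. Qed.

Lemma pr_absW_le a t : 0 < t -> 0 <= a ->
  pr P (absW a t) <= 2 * a * c0 / Num.sqrt t.
Proof.
move=> t0 a0; rewrite absWE pr_W//.
apply: (le_trans (normal_itv_le _ _)); rewrite ?sqrtr_gt0//; first lra.
by rewrite (_ : c0 / _ * _ = 2 * a * c0 / Num.sqrt t)//; ring.
Qed.

Lemma pr_absW_ge a t : 0 < t -> 0 <= a ->
  2 * a * c0 / Num.sqrt t * (1 - a ^+ 2 / (2 * t)) <= pr P (absW a t).
Proof.
move=> t0 a0; rewrite absWE pr_W//.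
apply: le_trans (normal_itv_ge _ _) => //; rewrite ?sqrtr_gt0//.
by rewrite sqr_sqrtr ?(ltW t0)// (_ : c0 / _ * (2 * a) = 2 * a * c0 / Num.sqrt t)//; ring.
Qed.

Lemma pr_incr_tail s t (k : nat) : 0 <= s -> s < t ->
  pr P [set w | 2 * k%:R * Num.sqrt (t - s) < `|W t w - W s w|] <=
  8 * 4^-1 ^+ k.
Proof.
move=> s0 st; have ts : 0 < Num.sqrt (t - s) by rewrite sqrtr_gt0 subr_gt0.
apply: le_trans (normal_tail k ts).
rewrite (pr_incr (A := [set x | 2 * k%:R * Num.sqrt (t - s) < `|x|]))//.
exact: measurable_gt_norm.
Qed.

(* Slice [-a, a] into K pieces; on each piece the increment is confined to an
   interval of length 2b + 2a/K, and K tends to infinity. *)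
Lemma pr_absW2_le a b s t : 0 < s -> s < t -> 0 <= a -> 0 <= b ->
  pr P (absW a s `&` absW b t) <=
  2 * a * c0 / Num.sqrt s * (2 * b * c0 / Num.sqrt (t - s)).
Proof.
move=> s0 st a0 b0.
have t0 : 0 < t by exact: lt_trans st.
set S := Num.sqrt s; set D := Num.sqrt (t - s).
have S0 : 0 < S by rewrite sqrtr_gt0.
have D0 : 0 < D by rewrite sqrtr_gt0 subr_gt0.
have cp := @c0_gt0 R.
have step (K : nat) : pr P (absW a s `&` absW b t) <=
    2 * a * c0 / S * (2 * b * c0 / D) + 4 * a ^+ 2 * c0 ^+ 2 / (S * D) / K.+1%:R.
  pose h := 2 * a / K.+1%:R.
  have h0 : 0 <= h by rewrite divr_ge0// mulr_ge0.
  pose x (i : nat) := - a + i%:R * h.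
  pose F i := [set w | `[x i, x i.+1]%classic (W s w)] `&`
     [set w | `[- b - x i.+1, b - x i]%classic (W t w - W s w)].
  apply: le_trans (_ : \sum_(i <- iota 0 K.+1) pr P (F i) <= _).
    apply: pr_union_le.
    - by apply: measurableI; exact/measurable_absW/ltW.
    - move=> i; apply: measurableI; first by apply: measurable_W_preimage; [exact: ltW|].
      by apply: measurable_W_incr; [exact: ltW|exact: ltW|].
    - move=> w [aWs bWt].
      have /andP[aW Wa] : - a <= W s w <= a by rewrite -ler_norml.
      have /andP[bW Wb] : - b <= W t w <= b by rewrite -ler_norml.
      have [|i iK /andP[xi xi1]] := exists_slice (K := K) (h := h) aW.
        rewrite (_ : K.+1%:R * h = 2 * a); first lra.
        by rewrite /h; field; rewrite addrC natr1.
      exists i; first by rewrite mem_iota add0n.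
      by split; rewrite /= in_itv/=; apply/andP; split => //; rewrite /x; lra.
  have x1 i : x i.+1 = x i + h by rewrite /x -natr1; ring.
  have bnd i : pr P (F i) <= c0 / S * h * (c0 / D * (2 * b + h)).
    rewrite /F pr_indep//; apply: ler_pM; try exact: pr_ge0.
      rewrite pr_W//; apply: le_trans (normal_itv_le _ _) _ => //.
        by rewrite x1; lra.
      by rewrite x1 (_ : x i + h - x i = h)//; ring.
    rewrite (pr_incr (ltW s0) st)//; apply: le_trans (normal_itv_le _ _) _ => //.
      by rewrite x1; lra.
    by rewrite x1 (_ : b - x i - _ = 2 * b + h)//; ring.
  apply: le_trans (ler_sum _ (fun i _ => bnd i)) _.
  rewrite big_const_seq count_predT size_iota iter_addr_0 -mulr_natr.
  rewrite le_eqVlt; apply/orP; left; apply/eqP; rewrite /h; field.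
  by rewrite !gt_eqF// addrC natr1.
apply/ler_addgt0Pr => e e0.
pose M := 4 * a ^+ 2 * c0 ^+ 2 / (S * D).
have M0 : 0 <= M by rewrite divr_ge0// ?mulr_ge0 ?sqr_ge0// ltW.
apply: le_trans (step (Num.truncn (M / e))) _; rewrite lerD2l -/M.
rewrite ler_pdivrMr// mulrC -ler_pdivrMr//.
by rewrite ltW// truncnS_gt.
Qed.

End brownian_motion_estimates.

(** * Sums of powers and sums over distances *)

Section power_sums.
Context {R : realType}.
Implicit Types (x al : R) (g : nat -> R).

(* The tangent-line bound of a concave power is an instance of Young's
   inequality. *)
Lemma powR_le_tangent x al : 0 <= x -> 0 < al -> al < 1 ->
  x `^ al <= al * x + (1 - al).
Proof.
move=> x0 al0 al1.
have := @conjugate_powR R (x `^ al) 1 al^-1 (1 - al)^-1 (powR_ge0 _ _) ler01.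
rewrite !invr_gt0 subr_gt0 !invrK => /(_ al0 al1).
rewrite mulr1 -powRrM divff ?gt_eqF// powRr1// powR1 mul1r (mulrC x).
by apply; ring.
Qed.

(** By concavity al (i+1)^(al-1) <= (i+1)^al - i^al, and the right side telescopes. Factoring out
    (i+1)^al turns this into the tangent bound at i / (i+1). *)
Lemma sum_powR_le al (N : nat) : 0 < al -> al < 1 ->
  \sum_(0 <= i < N) i.+1%:R `^ (al - 1) <= N%:R `^ al / al.
Proof.
move=> al0 al1; elim: N => [|N ih].
  by rewrite big_geq// divr_ge0 ?powR_ge0 ?ltW.
rewrite big_nat_recr//=; apply: (le_trans (lerD ih (lexx _))).
rewrite -(@ler_pM2r _ al)// mulrDl divfK ?gt_eqF// divfK ?gt_eqF//.
set n1 : R := N.+1%:R.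
have n10 : 0 < n1 by rewrite ltr0n.
have -> : N%:R `^ al = n1 `^ al * (N%:R / n1) `^ al.
  rewrite -powRM ?divr_ge0 ?(ltW n10)//.
  by rewrite mulrC divfK ?gt_eqF.
have -> : n1 `^ (al - 1) = n1 `^ al / n1.
  by rewrite powRB ?powRr1 ?(ltW n10)//; apply/implyP => _; rewrite gt_eqF.
have h : (N%:R / n1) `^ al <= al * (N%:R / n1) + (1 - al).
  by apply: powR_le_tangent => //; rewrite divr_ge0// ltW.
have p0 : 0 < n1 `^ al by rewrite powR_gt0.
apply: (@le_trans _ _ (n1 `^ al * (al * (N%:R / n1) + (1 - al)) + n1 `^ al / n1 * al)).
  by rewrite lerD2r ler_wpM2l// ltW.
have e : N%:R = n1 - 1 :> R by rewrite /n1 -natr1 addrK.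
by rewrite e le_eqVlt; apply/orP; left; apply/eqP; field; rewrite gt_eqF.
Qed.

Lemma sum_inv_sqrt_le (N : nat) :
  \sum_(0 <= i < N) (Num.sqrt i.+1%:R)^-1 <= 2 * Num.sqrt N%:R :> R.
Proof.
have h2 : 2^-1 < 1 :> R by lra.
have h0 : 0 < 2^-1 :> R by lra.
have := sum_powR_le N h0 h2; rewrite -powR12_sqrt// invrK mulrC; apply: le_trans.
apply: ler_sum => i _; rewrite -powR12_sqrt// -powRN.
by rewrite le_eqVlt; apply/orP; left; apply/eqP; congr (_ `^ _); lra.
Qed.

(** The distance |i - j|: at least one of the two truncated differences vanishes. *)
Definition ndist (i j : nat) := ((i - j) + (j - i))%N.

Lemma sum_nat_widen_ge0 g (k K : nat) : (forall i, 0 <= g i) -> (k <= K)%N ->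
  \sum_(0 <= i < k) g i <= \sum_(0 <= i < K) g i.
Proof.
move=> g0 kK; rewrite (big_cat_nat (leq0n k) kK)/= lerDl.
exact: sumr_ge0.
Qed.

(** Each distance occurs at most once on either side of i, and nonnegativity lets both sides be
    extended to the full range. *)
Lemma sum_ndist_le g (M N i : nat) : (forall d, 0 <= g d) ->
  (M <= i < N)%N ->
  \sum_(M <= j < N) g (ndist i j) <=
  g 0%N + 2 * \sum_(0 <= d < N - M) g d.+1.
Proof.
move=> g0 /andP[Mi iN].
rewrite (big_cat_nat Mi (ltnW iN))/= (big_ltn iN).
have -> : g (ndist i i) = g 0%N by rewrite /ndist subnn.
have -> : \sum_(M <= j < i) g (ndist i j) = \sum_(0 <= d < i - M) g d.+1.
  rewrite big_nat_rev/= -{1}(add0n M) big_addn; apply: eq_big_nat => d /andP[_ di].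
  by congr g; rewrite /ndist; lia.
have -> : \sum_(i.+1 <= j < N) g (ndist i j) = \sum_(0 <= d < N - i.+1) g d.+1.
  rewrite -{1}(add0n i.+1) big_addn; apply: eq_big_nat => d /andP[_ di].
  by congr g; rewrite /ndist; lia.
have g0' d : 0 <= g d.+1 by [].
have h1 := sum_nat_widen_ge0 g0' (leq_sub2r M (ltnW iN)).
have h2 := sum_nat_widen_ge0 g0' (leq_sub2l N (leqW Mi)).
by lra.
Qed.

End power_sums.

(** * First and second moments within one scale *)

Section moments.
Context {R : realType} {d : measure_display} {T : measurableType d}.
Variables (P : probability T R) (B : R -> T -> R).
Hypothesis BM : brownian_motion P B.
Local Notation c0 := (@c0 R).
Local Notation absW := (absW B).
Local Notation pr := (pr P).

(** The integers of the shell S_(m+1): scales are numbered one below shells. *)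
Definition scale (m : nat) := index_iota (2 ^ m) (2 ^ m.+1).
Definition root2 (m : nat) : R := Num.sqrt (2 ^ m)%:R.
(** Sum over the scale of the upper bounds for P(|W i| <= a). It normalises the visit counts in
    place of the exact mean. *)
Definition gmean (a : R) (m : nat) : R :=
  \sum_(i <- scale m) 2 * a * c0 / Num.sqrt i%:R.

Lemma root2_gt0 m : 0 < root2 m.
Proof. by rewrite sqrtr_gt0 ltr0n expn_gt0. Qed.

Lemma root2_sqr m : root2 m ^+ 2 = (2 ^ m)%:R.
Proof. by rewrite sqr_sqrtr. Qed.

Lemma scaleP m i : (i \in scale m) = (2 ^ m <= i < 2 ^ m.+1)%N.
Proof. by rewrite mem_index_iota. Qed.

Lemma scale_gt0 m i : i \in scale m -> (0 < i)%N.
Proof. by rewrite scaleP => /andP[+ _]; apply: leq_trans; rewrite expn_gt0. Qed.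

Lemma gmean_ge a m : 0 <= a -> a * c0 * root2 m <= gmean a m.
Proof.
move=> a0; have cp := @c0_gt0 R.
apply: (@le_trans _ _ (\sum_(i <- scale m) a * c0 / root2 m)).
  rewrite /scale sumr_const_nat expnS mul2n -addnn addnK -mulr_natl -root2_sqr.
  have r0 := root2_gt0 m.
  by rewrite le_eqVlt; apply/orP; left; apply/eqP; field; rewrite gt_eqF.
rewrite /gmean big_seq [leRHS]big_seq; apply: ler_sum => i im.
have i0 : 0 < i%:R :> R by rewrite ltr0n (scale_gt0 im).
have -> : 2 * a * c0 / Num.sqrt i%:R = a * c0 * (2 / Num.sqrt i%:R) by ring.
apply: ler_wpM2l; first by rewrite mulr_ge0 ?(ltW cp).
rewrite ler_pdivlMr ?sqrtr_gt0// mulrC ler_pdivrMr ?root2_gt0//.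
have -> : 2 * root2 m = Num.sqrt (2 ^ m.+2)%:R.
  rewrite /root2 !expnS mulnA natrM sqrtrM// -[X in _ = X * _]ger0_norm ?sqrtr_ge0//.
  by rewrite (_ : (2 * 2)%:R = 2 ^+ 2)// ?sqrtr_sqr ?normr_id ?ger0_norm// -natrX.
apply: ler_wsqrtr; rewrite ler_nat.
move: im; rewrite scaleP => /andP[_ /ltnW im].
by apply: leq_trans im _; rewrite leq_exp2l.
Qed.

(** For j < i the two-time estimate produces 1 / sqrt j instead of 1 / sqrt i. Within a scale i < 2
    j, and trading one for the other costs a factor 2, whence 4 a where 2 a is expected. *)
Lemma pr_pair_le a m i j : 0 <= a -> i \in scale m -> j \in scale m ->
  pr (absW a i%:R `&` absW a j%:R) <=
  2 * a * c0 / Num.sqrt i%:R *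
  (if i == j then 1 else 4 * a * c0 / Num.sqrt (ndist i j)%:R).
Proof.
move=> a0 im jm.
have i0 : 0 < i%:R :> R by rewrite ltr0n (scale_gt0 im).
have j0 : 0 < j%:R :> R by rewrite ltr0n (scale_gt0 jm).
have cp := @c0_gt0 R.
have [->|ij] := eqVneq i j.
  by rewrite setIid mulr1; exact: pr_absW_le.
have [ltij|ltji] := ltnP i j.
  have := pr_absW2_le BM (s := i%:R) (t := j%:R) (a := a) (b := a) i0.
  rewrite ltr_nat => /(_ ltij a0 a0)/le_trans; apply.
  rewrite ler_wpM2l ?divr_ge0 ?mulr_ge0 ?(ltW cp)//.
  rewrite /ndist (eqP (ltnW ltij)) add0n natrB ?(ltnW ltij)//.
  by rewrite ler_wpM2r ?invr_ge0 ?sqrtr_ge0//; nra.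
have {}ltji : (j < i)%N by rewrite ltn_neqAle eq_sym ij.
rewrite setIC.
have := pr_absW2_le BM (s := j%:R) (t := i%:R) (a := a) (b := a) j0.
rewrite ltr_nat => /(_ ltji a0 a0)/le_trans; apply.
rewrite /ndist (eqP (ltnW ltji)) addn0 natrB ?(ltnW ltji)//.
set D := Num.sqrt (_ - _); have D0 : 0 < D by rewrite sqrtr_gt0 subr_gt0 ltr_nat.
have e : (Num.sqrt j%:R)^-1 <= 2 * (Num.sqrt i%:R)^-1 :> R.
  rewrite ler_pdivlMr ?sqrtr_gt0// mulrC ler_pdivrMr ?sqrtr_gt0//.
  have -> : 2 = Num.sqrt (2 ^+ 2) :> R by rewrite sqrtr_sqr ger0_norm.
  rewrite -sqrtrM ?sqr_ge0//; apply: ler_wsqrtr.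
  rewrite -natrX -natrM ler_nat.
  move: im jm; rewrite !scaleP !expnS => /andP[_ im] /andP[jm _].
  by lia.
have -> : 2 * a * c0 / Num.sqrt i%:R * (4 * a * c0 / D) =
  2 * a * c0 * (2 * a * c0 / D) * (2 * (Num.sqrt i%:R)^-1) by ring.
rewrite mulrAC; apply: ler_wpM2l => //.
by rewrite !mulr_ge0 ?invr_ge0 ?(ltW cp) ?(ltW D0).
Qed.

(** For fixed i the pair bound depends on j only through the distance, so the inner sum is at most a
    diagonal term plus twice a sum over distances; 8 is twice the 4 of [pr_pair_le]. The kernel is 1
    for second moments and a Riesz kernel for energies. *)
Lemma energy_le (kap : nat -> R) a m : (forall n, 0 <= kap n) -> 0 <= a ->
  \sum_(i <- scale m) \sum_(j <- scale m)
     kap (ndist i j) * pr (absW a i%:R `&` absW a j%:R) <=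
  gmean a m * (kap 0%N + 8 * a * c0 *
     \sum_(0 <= n < 2 ^ m) kap n.+1 / Num.sqrt n.+1%:R).
Proof.
move=> k0 a0; have cp := @c0_gt0 R.
rewrite /gmean mulr_suml big_seq [leRHS]big_seq.
apply: ler_sum => i im.
pose g n : R := kap n * (if n is 0%N then 1 else 4 * a * c0 / Num.sqrt n%:R).
have g0 n : 0 <= g n.
  rewrite /g mulr_ge0//; case: n => // n.
  by rewrite divr_ge0 ?sqrtr_ge0 ?mulr_ge0 ?(ltW cp).
have mu0 : 0 <= 2 * a * c0 / Num.sqrt i%:R.
  by rewrite divr_ge0 ?sqrtr_ge0 ?mulr_ge0 ?(ltW cp).
apply: (@le_trans _ _ (2 * a * c0 / Num.sqrt i%:R *
    \sum_(j <- scale m) g (ndist i j))).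
  rewrite mulr_sumr big_seq [leRHS]big_seq; apply: ler_sum => j jm.
  apply: (le_trans (ler_wpM2l (k0 _) (pr_pair_le a0 im jm))).
  rewrite /g mulrCA ler_wpM2l//.
  have [->|ij] := eqVneq i j; first by rewrite /ndist subnn.
  case E : (ndist i j) => [|n]//.
  by move: ij; rewrite /ndist in E *; move/eqP; lia.
rewrite ler_wpM2l//; move: (im); rewrite scaleP => im'.
apply: le_trans (sum_ndist_le g0 im') _.
rewrite {1}/g mulr1 lerD2l expnS mul2n -addnn addnK -mulrA -mulrA.
rewrite !mulr_sumr; apply: ler_sum => n _; rewrite /g.
by rewrite le_eqVlt; apply/orP; left; apply/eqP; ring.
Qed.

End moments.

(** * Decorrelation of distant scales *)

Section far_scales.
Context {R : realType} {d : measure_display} {T : measurableType d}.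
Variables (P : probability T R) (B : R -> T -> R).
Hypothesis BM : brownian_motion P B.
Local Notation c0 := (@c0 R).
Local Notation absW := (absW B).
Local Notation pr := (pr P).

Lemma pr_far_pair_le a b p q L i j : 0 <= a -> 0 <= b -> (1 < L)%N ->
  (p + L <= q)%N -> i \in scale p -> j \in scale q ->
  pr (absW a i%:R `&` absW b j%:R) <=
  2 * a * c0 / Num.sqrt i%:R * (2 * b * c0 / Num.sqrt j%:R) *
  (1 + 4 / 2 ^+ L).
Proof.
move=> a0 b0 L1 pLq ip jq.
have i0 : 0 < i%:R :> R by rewrite ltr0n (scale_gt0 ip).
have j0 : 0 < j%:R :> R by rewrite ltr0n (scale_gt0 jq).
have cp := @c0_gt0 R.
move: ip jq; rewrite !scaleP => /andP[_ ip] /andP[jq _].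
have ij : (i * 2 ^ L < 2 * j)%N.
  apply: (@leq_trans (2 ^ p.+1 * 2 ^ L)); first by rewrite ltn_pmul2r ?expn_gt0.
  rewrite -expnD addSn expnS leq_pmul2l//.
  by apply: leq_trans jq; rewrite leq_exp2l.
have L4 : (4 <= 2 ^ L)%N by rewrite (@leq_exp2l 2 2).
have ltij : (i < j)%N by nia.
have := pr_absW2_le BM (s := i%:R) (t := j%:R) (a := a) (b := b) i0.
rewrite ltr_nat => /(_ ltij a0 b0)/le_trans; apply.
rewrite -[leRHS]mulrA; apply: ler_wpM2l.
  by rewrite divr_ge0 ?sqrtr_ge0 ?mulr_ge0 ?(ltW cp).
rewrite -[leRHS]mulrA; apply: ler_wpM2l; first by rewrite !mulr_ge0 ?(ltW cp).
have D0 : 0 < Num.sqrt (j%:R - i%:R) :> R.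
  by rewrite sqrtr_gt0 subr_gt0 ltr_nat.
have X0 : 4 <= 2 ^+ L :> R by rewrite -natrX ler_nat.
(* The gap of L scales gives i <= x j, and 1 / sqrt(j - i) <= (1 + 2 x) / sqrt j because (1 + 2 x)^2
   (1 - x) = 1 + x (3 - 4 x^2) >= 1 for x <= 1/2, which is where 1 < L enters. *)
pose x : R := 2 / 2 ^+ L.
have x0 : 0 <= x by rewrite divr_ge0// exprn_ge0.
have x1 : x <= 2^-1 by rewrite ler_pdivrMr ?exprn_gt0//; lra.
have -> : 4 / 2 ^+ L = 2 * x by rewrite /x; ring.
have ix : i%:R <= x * j%:R.
  rewrite /x mulrAC ler_pdivlMr ?exprn_gt0//.
  by rewrite -!natrX -!natrM ler_nat ltnW.
rewrite mulrC ler_pdivlMr ?sqrtr_gt0// mulrC ler_pdivrMr//.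
have -> : 1 + 2 * x = Num.sqrt ((1 + 2 * x) ^+ 2).
  by rewrite sqrtr_sqr ger0_norm//; lra.
rewrite -sqrtrM ?sqr_ge0//; apply: ler_wsqrtr.
have h1 : (1 + 2 * x) ^+ 2 * (j%:R - x * j%:R) <=
   (1 + 2 * x) ^+ 2 * (j%:R - i%:R).
  by apply: ler_wpM2l; [exact: sqr_ge0|lra].
apply: le_trans h1.
have -> : (1 + 2 * x) ^+ 2 * (j%:R - x * j%:R) =
   j%:R + j%:R * (x * (3 - 4 * x ^+ 2)) by ring.
rewrite lerDl mulr_ge0 ?(ltW j0)// mulr_ge0//.
by nra.
Qed.

Lemma gmean_gt0 a m : 0 < a -> 0 < gmean a m :> R.
Proof.
move=> a0; apply: lt_le_trans (gmean_ge _ (ltW a0)).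
by rewrite !mulr_gt0 ?c0_gt0 ?root2_gt0.
Qed.

Variables (a : nat -> R) (theta : R).
Hypothesis a_gt0 : forall m, 0 < a m.
Hypothesis a_le : forall m, a m ^+ 2 <= theta ^+ 2 * (2 ^ m)%:R.
Let mean m := gmean (a m) m.

(** Pairs (scale, point) over the K scales N, N + L, ..., so that the sum of all normalised counts
    is a single [wsum]. *)
Definition visits K N L :=
  [seq ((N + L * k)%N, i) | k <- iota 0 K, i <- scale (N + L * k)].
Definition vweight (x : nat * nat) : R := (gmean (a x.1) x.1)^-1.
Definition vevent (x : nat * nat) : set T := absW (a x.1) x.2%:R.

Lemma vweight_ge0 x : 0 <= vweight x.
Proof. by rewrite invr_ge0 ltW// gmean_gt0. Qed.

Lemma measurable_vevent x : measurable (vevent x).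
Proof. exact: (measurable_absW BM). Qed.

(** [a_le] keeps a^2 / (2 i) below theta^2 / 2 on the whole scale, so [gmean] exceeds the true mean
    by a controlled factor only. *)
Lemma expected_visits_ge m :
  1 - theta ^+ 2 / 2 <= \sum_(i <- scale m) (mean m)^-1 * pr (absW (a m) i%:R).
Proof.
have mp : 0 < mean m by exact: gmean_gt0.
rewrite -mulr_sumr [leRHS]mulrC ler_pdivlMr// [leLHS]mulrC /mean /gmean mulr_suml.
rewrite big_seq [leRHS]big_seq; apply: ler_sum => i im.
have i0 : 0 < i%:R :> R by rewrite ltr0n (scale_gt0 im).
apply: le_trans (pr_absW_ge BM i0 (ltW (a_gt0 m))).
apply: ler_wpM2l.
  by rewrite divr_ge0 ?sqrtr_ge0 ?mulr_ge0 ?(ltW (a_gt0 _)) ?(ltW c0_gt0).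
rewrite lerD2l lerN2 invfM mulrCA [leRHS]mulrC ler_wpM2l ?invr_ge0//.
rewrite ler_pdivrMr//; apply: le_trans (a_le m) _.
apply: ler_wpM2l; first exact: sqr_ge0.
by rewrite ler_nat; move: im; rewrite scaleP => /andP[].
Qed.

Let second_moment p q : R := \sum_(i <- scale p) \sum_(j <- scale q)
   (mean p)^-1 * (mean q)^-1 * pr (absW (a p) i%:R `&` absW (a q) j%:R).

Lemma second_moment_far L p q : (1 < L)%N -> (p + L <= q)%N ->
  second_moment p q <= 1 + 4 / 2 ^+ L.
Proof.
move=> L1 pLq.
have mp : 0 < mean p by exact: gmean_gt0.
have mq : 0 < mean q by exact: gmean_gt0.
have -> : 1 + 4 / 2 ^+ L = \sum_(i <- scale p) \sum_(j <- scale q)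
    (mean p)^-1 * (mean q)^-1 * (2 * a p * c0 / Num.sqrt i%:R *
     (2 * a q * c0 / Num.sqrt j%:R) * (1 + 4 / 2 ^+ L)).
  transitivity ((mean p)^-1 * (mean q)^-1 * (1 + 4 / 2 ^+ L) * (mean p * mean q)).
    by set D := 1 + _; field; rewrite !gt_eqF.
  rewrite [X in _ * X]big_distrlr/= mulr_sumr; apply: eq_bigr => i _.
  by rewrite mulr_sumr; apply: eq_bigr => j _; ring.
rewrite /second_moment big_seq [leRHS]big_seq; apply: ler_sum => i ip.
rewrite big_seq [leRHS]big_seq; apply: ler_sum => j jq.
apply: ler_wpM2l; first by rewrite mulr_ge0 ?invr_ge0 ?(ltW mp) ?(ltW mq).
by apply: (pr_far_pair_le (p := p) (q := q)) => //; exact: ltW.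
Qed.

(** With kernel 1 the energy is at most gmean (1 + 16 a c0 sqrt(2^m)). Both 1 and a c0 sqrt(2^m) are
    at most gmean, which gives 1 + 16 = 17. *)
Lemma second_moment_same m : 1 <= a m * c0 * root2 m ->
  second_moment m m <= 17.
Proof.
move=> h1.
have mp : 0 < mean m by exact: gmean_gt0.
have mg : a m * c0 * root2 m <= mean m by exact/gmean_ge/ltW.
have := @energy_le _ _ _ P B BM (fun=> 1) (a m) m (fun=> ler01) (ltW (a_gt0 m)).
rewrite -/(mean m).
have -> : second_moment m m = (mean m)^-1 * (mean m)^-1 *
    \sum_(i <- scale m) \sum_(j <- scale m)
       1 * pr (absW (a m) i%:R `&` absW (a m) j%:R).
  rewrite /second_moment mulr_sumr; apply: eq_bigr => i _.
  by rewrite mulr_sumr; apply: eq_bigr => j _; rewrite mul1r.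
set E := \sum_(i <- _) _ => hE.
rewrite mulrC mulrA ler_pdivrMr// ler_pdivrMr//.
apply: (le_trans hE); rewrite mulrC.
apply: ler_wpM2r; first exact: ltW.
have := sum_inv_sqrt_le (R := R) (2 ^ m); rewrite -/(root2 m).
under [X in _ -> 1 + _ * X <= _]eq_bigr do rewrite mul1r.
set S := \sum_(0 <= n < _) _ => hS.
have hS' : 8 * a m * c0 * S <= 8 * a m * c0 * (2 * root2 m).
  by apply: ler_wpM2l => //; rewrite !mulr_ge0 ?(ltW (a_gt0 _)) ?(ltW c0_gt0).
by lra.
Qed.

Lemma second_moment_sym p q : second_moment p q = second_moment q p.
Proof.
rewrite /second_moment exchange_big/=; apply: eq_bigr => i _.
by apply: eq_bigr => j _; rewrite setIC (mulrC (mean p)^-1).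
Qed.

(** Every pair of scales is charged 1 + 4 / 2^L and each diagonal pair 17 more. In Chebyshev's
    inequality the two terms K^2 on the right cancel against 2 K^2 (1 - theta^2 / 2) on the left, up
    to K^2 theta^2. *)
Lemma visits_lower_tail K N L : (1 < L)%N ->
  (forall m, (N <= m)%N -> 1 <= a m * c0 * root2 m) ->
  K%:R ^+ 2 / 4 *
    pr [set w | wsum (visits K N L) vweight vevent w <= K%:R / 2] <=
  K%:R ^+ 2 * (theta ^+ 2 + 4 / 2 ^+ L) + 17 * K%:R.
Proof.
move=> L1 hN.
have := @chebyshev_wsum _ _ _ P _ (visits K N L) vweight vevent K%:R
   vweight_ge0 measurable_vevent (ler0n _ _).
set Q := pr _.
have E1 : K%:R * (1 - theta ^+ 2 / 2) <=
   \sum_(x <- visits K N L) vweight x * pr (vevent x).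
  rewrite /visits big_allpairs_dep/=.
  apply: (@le_trans _ _ (\sum_(k <- iota 0 K) (1 - theta ^+ 2 / 2))).
    by rewrite big_const_seq count_predT size_iota iter_addr_0 mulr_natl.
  by apply: ler_sum => k _; exact: expected_visits_ge.
have E2 : \sum_(x <- visits K N L) \sum_(y <- visits K N L)
     vweight x * vweight y * pr (vevent x `&` vevent y) <=
     K%:R ^+ 2 * (1 + 4 / 2 ^+ L) + 17 * K%:R.
  have -> : \sum_(x <- visits K N L) \sum_(y <- visits K N L)
     vweight x * vweight y * pr (vevent x `&` vevent y) =
     \sum_(k <- iota 0 K) \sum_(l <- iota 0 K)
       second_moment (N + L * k)%N (N + L * l)%N.
    rewrite /visits big_allpairs_dep/=; apply: eq_bigr => k _.
    under eq_bigr => i _ do rewrite big_allpairs_dep/=.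
    by rewrite exchange_big.
  have D0 : 0 <= 4 / 2 ^+ L :> R by rewrite divr_ge0// exprn_ge0.
  apply: (@le_trans _ _ (\sum_(k <- iota 0 K) \sum_(l <- iota 0 K)
       ((1 + 4 / 2 ^+ L) + (if l == k then 17 else 0)))).
    apply: ler_sum => k _; apply: ler_sum => l _.
    have [->|lk] := eqVneq l k.
      have := second_moment_same (hN (N + L * k)%N (leq_addr _ _)); lra.
    rewrite addr0; have [ltkl|ltlk] := ltnP k l.
      by apply: second_moment_far => //; nia.
    rewrite second_moment_sym; apply: second_moment_far => //.
    have : (l < k)%N by rewrite ltn_neqAle lk.
    by nia.
  under eq_bigr do rewrite big_split/=.
  rewrite big_split/= !big_const_seq !count_predT !size_iota !iter_addr_0.
  apply: lerD; first by rewrite -mulrnA -[leLHS]mulr_natl natrM expr2.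
  rewrite (_ : 17 * K%:R = \sum_(k <- iota 0 K) 17); last first.
    by rewrite big_const_seq count_predT size_iota iter_addr_0 mulr_natr.
  apply: ler_sum => k _; rewrite -big_mkcond/=.
  rewrite big_const_seq iter_addr_0 (count_uniq_mem k (iota_uniq 0 K)).
  by case: (k \in _); rewrite ?mulr1n ?mulr0n.
have K0 : 0 <= K%:R :> R by [].
have E1' : 2 * K%:R * (K%:R * (1 - theta ^+ 2 / 2)) <= 2 * K%:R *
   (\sum_(x <- visits K N L) vweight x * pr (vevent x)).
  by apply: ler_wpM2l => //; rewrite mulr_ge0.
move=> h; have := le_trans h (lerD E2 (lexx _)).
move: E1'; set Z := \sum_(_ <- _) _; set D := 4 / _.
by nra.
Qed.

End far_scales.

(** * Riesz energy within one scale *)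

Section energy_at_scale.
Context {R : realType} {d : measure_display} {T : measurableType d}.
Variables (P : probability T R) (B : R -> T -> R).
Hypothesis BM : brownian_motion P B.
Local Notation c0 := (@c0 R).

(** Riesz kernel at distance n, normalised by the end of the shell. The shift [n.+1] keeps the
    diagonal finite and, for rho >= 0, makes the kernel at least (2^(m+1) / l)^rho, the inverse of a
    cover weight, for any two integers sharing an interval of length l. *)
Definition riesz (rho : R) (m n : nat) : R := (2 ^+ m.+1 / n.+1%:R) `^ rho.

(** The diagonal costs 2^((m+1) rho) <= 2 sqrt(2^m), comparable to gmean. Off the diagonal the
    kernel meets the factor 1 / sqrt n of the pair bound, and n^(-rho - 1/2) sums up to at most 2^(m
    (1/2 - rho)) / (1/2 - rho) because rho < 1/2. *)
Lemma energy_at_scale_le a rho m : 0 < a -> 0 <= rho -> rho < 2^-1 ->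
  \sum_(i <- scale m) \sum_(j <- scale m)
     riesz rho m (ndist i j) * pr P (absW B a i%:R `&` absW B a j%:R) <=
  (2 / (a * c0) + 16 / (2^-1 - rho)) * gmean a m ^+ 2.
Proof.
move=> a0 r0 r1; have cp := @c0_gt0 R.
have acp : 0 < a * c0 by rewrite mulr_gt0.
have mg : a * c0 * root2 m <= gmean a m by exact/gmean_ge/ltW.
have rp := @root2_gt0 R m.
have mp : 0 < gmean a m by apply: lt_le_trans mg; rewrite !mulr_gt0.
have k0 n : 0 <= riesz rho m n by exact: powR_ge0.
apply: (le_trans (energy_le BM m k0 (ltW a0))).
rewrite expr2 mulrA mulrC; apply: ler_wpM2r; first exact: ltW.
have two_rho : (2 ^+ m.+1) `^ rho <= 2 * (2 ^+ m) `^ rho :> R.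
  rewrite exprS powRM ?exprn_ge0//; apply: ler_wpM2r; first exact: powR_ge0.
  rewrite -[leRHS]powRr1//; apply: ler_powR; first by rewrite ler1n.
  by lra.
have m1 : 1 <= 2 ^+ m :> R by rewrite exprn_ege1// ler1n.
have r2E : root2 m = (2 ^+ m) `^ 2^-1 :> R.
  by rewrite /root2 powR12_sqrt ?natrX// exprn_ge0.
have kap0 : riesz rho m 0 <= 2 / (a * c0) * gmean a m.
  rewrite /riesz divr1; apply: (le_trans two_rho).
  rewrite -mulrA; apply: ler_wpM2l => //.
  rewrite ler_pdivlMl//; apply: le_trans mg; apply: ler_wpM2l; first exact: ltW.
  by rewrite r2E; apply: ler_powR => //; exact: ltW.
have al0 : 0 < 2^-1 - rho by lra.
have al1 : 2^-1 - rho < 1 by lra.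
have S1 : \sum_(0 <= n < 2 ^ m) riesz rho m n.+1 / Num.sqrt n.+1%:R <=
   2 * root2 m / (2^-1 - rho).
  apply: (@le_trans _ _ (\sum_(0 <= n < 2 ^ m) (2 ^+ m.+1) `^ rho *
      n.+1%:R `^ ((2^-1 - rho) - 1))).
    apply: ler_sum => n _; rewrite /riesz powRM ?exprn_ge0 ?invr_ge0//.
    rewrite -mulrA; apply: ler_wpM2l; first exact: powR_ge0.
    have n0 : 0 < n.+1%:R :> R by rewrite ltr0n.
    have -> : (2^-1 - rho) - 1 = - rho + - 2^-1 by lra.
    rewrite powRD; last by apply/implyP => _; rewrite gt_eqF.
    rewrite [X in _ <= _ * X]powRN powR12_sqrt; last exact: ltW.
    apply: ler_wpM2r; first by rewrite invr_ge0 sqrtr_ge0.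
    rewrite powRN -powR_inv1 ?ltr0n// -powRrM mulN1r powRN.
    rewrite lef_pV2 ?posrE ?powR_gt0 ?ltr0n//.
    by apply: ge0_ler_powR; rewrite ?nnegrE// ler_nat.
  rewrite -mulr_sumr.
  apply: (le_trans (ler_wpM2l (powR_ge0 _ _) (sum_powR_le _ al0 al1))).
  rewrite mulrA; apply: ler_wpM2r; first by rewrite invr_ge0 ltW.
  apply: (le_trans (ler_wpM2r (powR_ge0 _ _) two_rho)).
  rewrite -mulrA; apply: ler_wpM2l => //.
  rewrite natrX -powRD; last by apply/implyP => _; rewrite gt_eqF// exprn_gt0.
  by rewrite r2E (_ : rho + (2^-1 - rho) = 2^-1)//; lra.
rewrite [leRHS]mulrDl; apply: lerD => //.
apply: (@le_trans _ _ (8 * a * c0 * (2 * root2 m / (2^-1 - rho)))).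
  by apply: ler_wpM2l => //; rewrite !mulr_ge0 ?(ltW a0) ?(ltW cp).
have -> : 8 * a * c0 * (2 * root2 m / (2^-1 - rho)) =
  16 / (2^-1 - rho) * (a * c0 * root2 m) by ring.
by apply: ler_wpM2l => //; rewrite divr_ge0// ltW.
Qed.

End energy_at_scale.

(** * Almost sure oscillation bounds by chaining *)

Lemma pr_bigcup_geometric {R : realType} {d : measure_display}
    {T : measurableType d} (P : probability T R) (F : nat -> set T) (C q : R) :
  (forall n, measurable (F n)) -> 0 <= q -> q < 1 ->
  (forall n, pr P (F n) <= C * q ^+ n) ->
  pr P (\bigcup_n F n) <= C / (1 - q).
Proof.
move=> mF q0 q1 le.
have mU : measurable (\bigcup_n F n) by exact: bigcupT_measurable.
rewrite -lee_fin -prE//.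
apply: (@le_trans _ _ (\sum_(n <oo) P (F n))%E).
  exact: measure_sigma_subadditive.
apply: (@le_trans _ _ (\sum_(n <oo) (geometric C q n)%:E)%E).
  by apply: lee_nneseries => // n _; have := le n; rewrite -lee_fin -prE.
have /cvg_geometric_series cv : `|q| < 1 by rewrite ger0_norm.
have -> : (\sum_(n <oo) (geometric C q n)%:E)%E = (C / (1 - q))%:E; last by [].
apply/cvg_lim => //.
rewrite (_ : (fun n => _) = EFin \o series (geometric C q)).
  by apply: cvg_EFin; [exact: nearW|exact: cv].
by apply/funext => n /=; rewrite sumEFin.
Qed.

Section chaining.
Context {R : realType}.
Variables (f : R -> R) (n : nat).
Local Notation delta j := ((2 : R) ^+ n / 2 ^+ j).

Hypothesis osc : forall j i, (i < 2 ^ j)%N ->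
  `|f (i.+1%:R * delta j) - f (i%:R * delta j)| <=
  2 * (n + j)%:R * Num.sqrt (delta j).

Lemma delta_gt0 j : 0 < delta j.
Proof. by rewrite divr_gt0// exprn_gt0. Qed.

Lemma deltaS j : delta j = 2 * delta j.+1.
Proof. by rewrite [2 ^+ j.+1]exprS; field; rewrite gt_eqF// exprn_gt0. Qed.

(** 7/5 bounds sqrt 2 from below, and it makes the additive constant 20 reproduce itself exactly: 28
    times 5/7 is 20. *)
Let root_delta j : 7 * Num.sqrt (delta j.+1) <= 5 * Num.sqrt (delta j).
Proof.
rewrite (deltaS j) (sqrtrM (delta j.+1) (ler0n R 2)).
have s0 := sqrtr_ge0 (delta j.+1).
have h : 7 <= 5 * Num.sqrt 2 :> R.
  have := sqrtr_ge0 (2 : R); have : Num.sqrt 2 ^+ 2 = 2 :> R by rewrite sqr_sqrtr.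
  by nra.
by rewrite mulrA; apply: ler_wpM2r.
Qed.

(* The bound is self-reproducing: passing from level j to level j+1 costs
   2(M+1) with M = n + j, and (6(M+1) + 20 + 2(M+1)) 5/7 <= 6M + 20. *)
Lemma chaining_dyadic K j i k : (i < 2 ^ j)%N ->
  (i * 2 ^ K <= k < i.+1 * 2 ^ K)%N ->
  `|f (k%:R * delta (j + K)) - f (i%:R * delta j)| <=
  (6 * (n + j)%:R + 20) * Num.sqrt (delta j).
Proof.
elim: K j i => [|K ih] j i ij ik.
  have -> : k = i by lia.
  by rewrite addn0 subrr normr0 mulr_ge0 ?sqrtr_ge0 ?addr_ge0 ?mulr_ge0.
(* [i'] is the child cell containing k: the left child shares its left end with cell i, the right
   child is one increment of level j + 1 away. *)
have [i' [i'j i'k i'e]] : exists i', [/\ (i' < 2 ^ j.+1)%N,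
    (i' * 2 ^ K <= k < i'.+1 * 2 ^ K)%N & i' = (2 * i)%N \/ i' = (2 * i).+1].
  rewrite expnS in ik; rewrite expnS.
  have [h|h] := ltnP k ((2 * i).+1 * 2 ^ K).
    by exists (2 * i)%N; split; [lia|lia|left].
  by exists (2 * i).+1; split; [lia|lia|right].
have := ih j.+1 i' i'j i'k; rewrite addSnnS => h1.
have h2 : `|f (i'%:R * delta j.+1) - f (i%:R * delta j)| <=
    2 * (n + j.+1)%:R * Num.sqrt (delta j.+1).
  have ie : i%:R * delta j = (2 * i)%:R * delta j.+1 by rewrite (deltaS j) natrM; ring.
  rewrite ie; case: i'e => ->.
    by rewrite subrr normr0 !mulr_ge0.
  by apply: osc; rewrite expnS ltn_pmul2l.
apply: le_trans (ler_distD (f (i'%:R * delta j.+1)) _ _) _.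
apply: (le_trans (lerD h1 h2)).
have := root_delta j; have := sqrtr_ge0 (delta j).
rewrite addnS -natr1; have : 0 <= (n + j)%:R :> R by [].
by set M : R := (n + j)%:R; set s := Num.sqrt _; set s' := Num.sqrt _; nra.
Qed.

Hypothesis cf : {within `[0, +oo[, continuous f}.

(** The dyadic bound does not depend on the depth K, so continuity carries it from dyadic points
    just below t to t itself. *)
Lemma chaining j i t : (i < 2 ^ j)%N ->
  i%:R * delta j <= t -> t < i.+1%:R * delta j ->
  `|f t - f (i%:R * delta j)| <= (6 * (n + j)%:R + 20) * Num.sqrt (delta j).
Proof.
move=> ij it ti.
have t0 : 0 <= t by apply: le_trans it; rewrite mulr_ge0// ltW// delta_gt0.
apply/ler_addgt0Pr => e e0.
have /subspace_continuousP/(_ t) := cf.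
rewrite /= in_itv/= t0 => /(_ isT)/cvgrPdist_lt/(_ e e0).
rewrite near_withinE => /nbhs_ballP[r /= r0 rP].
have [K hK] : exists K, delta (j + K) < r.
  pose K := (Num.truncn (delta j / r)).+1; exists K.
  have : delta j / r < 2 ^+ K.
    by apply: (lt_trans (truncnS_gt _)); rewrite -(natrX R 2 K) ltr_nat ltn_expl.
  rewrite exprD invfM mulrA; set D := _ / 2 ^+ j => h.
  by rewrite ltr_pdivrMr ?exprn_gt0// [ltRHS]mulrC -ltr_pdivrMr.
pose k := Num.truncn (t / delta (j + K)).
have dp := delta_gt0 (j + K).
have td : 0 <= t / delta (j + K) by rewrite divr_ge0// ltW.
have /andP[k1 k2] : k%:R <= t / delta (j + K) < k.+1%:R by exact: truncn_itv.
have dE : delta j = 2 ^+ K * delta (j + K).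
  by rewrite exprD; field; rewrite !gt_eqF ?exprn_gt0.
have ik : (i * 2 ^ K <= k < i.+1 * 2 ^ K)%N.
  apply/andP; split.
    rewrite -ltnS -(@ltr_nat R); apply: le_lt_trans k2.
    by rewrite ler_pdivlMr// natrM natrX -mulrA -dE.
  rewrite -(@ltr_nat R); apply: (le_lt_trans k1).
  by rewrite ltr_pdivrMr// natrM natrX -mulrA -dE.
have := chaining_dyadic ij ik.
set u := k%:R * delta (j + K) => h.
have ut : u <= t by rewrite /u -ler_pdivlMr.
have tu : t < u + delta (j + K).
  by rewrite /u -{2}(mul1r (delta (j + K))) -mulrDl natr1 -ltr_pdivrMr.
have hu : `|f t - f u| < e.
  apply: rP; first by rewrite /ball/= ger0_norm ?subr_ge0//; lra.
  by rewrite /= in_itv/= andbT /u mulr_ge0// ltW.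
apply: le_trans (ler_distD (f u) _ _) _.
by rewrite addrC; apply: lerD => //; exact: ltW.
Qed.

End chaining.

Section oscillation.
Context {R : realType} {d : measure_display} {T : measurableType d}.
Variables (P : probability T R) (B : R -> T -> R).
Hypothesis BM : brownian_motion P B.
Local Notation W := (shiftedBM B).
Local Notation delta n j := ((2 : R) ^+ n / 2 ^+ j).

Definition bad_increment n j i := [set w |
  2 * (n + j)%:R * Num.sqrt (delta n j) <
  `|W (i.+1%:R * delta n j) w - W (i%:R * delta n j) w|].

Lemma measurable_bad_increment n j i : measurable (bad_increment n j i).
Proof.
have dp := @delta_gt0 R n j.
apply: (measurable_W_incr BM (s := i%:R * delta n j) (t := i.+1%:R * delta n j)
  (A := [set x | 2 * (n + j)%:R * Num.sqrt (delta n j) < `|x| ])).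
- by rewrite mulr_ge0// ltW.
- by rewrite mulr_ge0// ltW.
- exact: measurable_gt_norm.
Qed.

Lemma pr_bad_increment_le n j i : pr P (bad_increment n j i) <= 8 * 4^-1 ^+ (n + j).
Proof.
have dp := @delta_gt0 R n j.
have := @pr_incr_tail _ _ _ _ _ BM (i%:R * delta n j) (i.+1%:R * delta n j) (n + j).
have -> : i.+1%:R * delta n j - i%:R * delta n j = delta n j.
  by rewrite -mulrBl -natr1 addrAC subrr add0r mul1r.
apply; first by rewrite mulr_ge0// ltW.
by rewrite ltr_pM2r// ltr_nat.
Qed.

(** Level j has 2^j increments, each bad with probability at most 8 / 4^(n+j); summing over j leaves
    16 / 4^n, and Borel-Cantelli applies in n. All levels are kept: those with j > n resolve times
    below 1 and serve the lower bound on the mass. *)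
Lemma ae_oscillation : {ae P, forall w, exists N, forall n, (N <= n)%N ->
  forall j i t, (i < 2 ^ j)%N -> i%:R * delta n j <= t ->
    t < i.+1%:R * delta n j ->
  `|B t w - B (i%:R * delta n j) w| <=
    (6 * (n + j)%:R + 20) * Num.sqrt (delta n j)}.
Proof.
pose G n j := \bigcup_(i in `I_(2 ^ j)) bad_increment n j i.
have mG n j : measurable (G n j).
  by apply: bigcup_measurable => i _; exact: measurable_bad_increment.
have prG n j : pr P (G n j) <= 8 * 4^-1 ^+ n * 2^-1 ^+ j.
  apply: (@le_trans _ _ (\sum_(i <- iota 0 (2 ^ j)) pr P (bad_increment n j i))).
    apply: pr_union_le => //; first exact: measurable_bad_increment.
    by move=> w [i /= ij h]; exists i => //; rewrite mem_iota.
  apply: (le_trans (ler_sum _ (fun i _ => pr_bad_increment_le n j i))).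
  rewrite big_const_seq count_predT size_iota iter_addr_0 -[leLHS]mulr_natr.
  have -> : (4^-1 : R) = 2^-1 * 2^-1 by field.
  rewrite exprD natrX !exprMn (exprVn _ j).
  rewrite le_eqVlt; apply/orP; left; apply/eqP.
  by field; rewrite gt_eqF// exprn_gt0.
have mU n : measurable (\bigcup_j G n j) by exact: bigcupT_measurable.
have h2 : (2^-1 : R) < 1 by lra.
have prU n : pr P (\bigcup_j G n j) <= 16 * 4^-1 ^+ n.
  apply: (le_trans (@pr_bigcup_geometric _ _ _ P (G n) (8 * 4^-1 ^+ n) 2^-1
    (mG n) _ h2 (prG n))) => //.
  by rewrite le_eqVlt; apply/orP; left; apply/eqP; field.
have h4 : (4^-1 : R) < 1 by lra.
have bc := borel_cantelli_geometric mU _ h4 prU.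
have [_ cB _ _] := BM.
apply: filterS2 cB (bc _) => // w [_ cw] [N hN].
exists N => n Nn j i t ij it ti.
apply: (@chaining R (fun t => B t w) n) => // j' i' ij'.
rewrite leNgt; apply/negP => h; apply: (hN n Nn); exists j' => //; exists i' => //=.
by rewrite /bad_increment/= /shiftedBM opprB addrA subrK.
Qed.

End oscillation.

(** * Frequent visits and divergence of energies *)

Section lower_bound_events.
Context {R : realType} {d : measure_display} {T : measurableType d}.
Variables (P : probability T R) (B : R -> T -> R).
Hypothesis BM : brownian_motion P B.
Local Notation c0 := (@c0 R).

Definition visit_count (a : R) m w : R :=
  \sum_(i <- scale m) \1_(absW B a i%:R) w.

Definition visit_energy (a rho : R) m w : R :=
  \sum_(i <- scale m) \sum_(j <- scale m)
    riesz rho m (ndist i j) * \1_(absW B a i%:R `&` absW B a j%:R) w.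

Lemma exists_pow2_gt (x : R) : exists L : nat, x < 2 ^+ L.
Proof.
exists (Num.truncn x).+1; apply: (lt_trans (truncnS_gt _)).
by rewrite -natrX ltr_nat ltn_expl.
Qed.

Lemma exists_nat_gt (x : R) : exists K : nat, x < K%:R.
Proof. by exists (Num.truncn x).+1; exact: truncnS_gt. Qed.

Lemma root2E m : root2 m = ((2 ^ m)%:R : R) `^ 2^-1.
Proof. by rewrite /root2 powR12_sqrt. Qed.

Lemma root2_large (c : R) : 0 < c -> exists N, forall m, (N <= m)%N -> 1 <= c * root2 m.
Proof.
move=> cp; have [N hN] := exists_pow2_gt (c^-1 ^+ 2).
exists N => m Nm; rewrite -ler_pdivrMl// mulr1 /root2.
rewrite -[leLHS](ger0_norm (ltW _)) ?invr_gt0// -sqrtr_sqr; apply: ler_wsqrtr.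
by apply: ltW; apply: (lt_le_trans hN); rewrite natrX ler_weXn2l// ler1n.
Qed.

(** Makes each of the three errors in the Chebyshev bound at most eta / 32, for every large number K
    of scales. *)
Lemma small_parameters (eta : R) : 0 < eta ->
  exists (theta : R) (L K0 : nat), [/\ 0 < theta, theta <= 2^-1, (1 < L)%N &
   forall K, (K0 <= K)%N -> (0 < K)%N /\
     4 * (theta ^+ 2 + 4 / 2 ^+ L + 17 / K%:R) <= eta].
Proof.
move=> e0; pose theta : R := Num.min 2^-1 (eta / 32).
have [L hL] := exists_pow2_gt (128 / eta).
have [K0 hK] := exists_nat_gt (544 / eta).
have t0 : 0 < theta by rewrite lt_min; apply/andP; split; [lra|rewrite divr_gt0].
have t1 : theta <= 2^-1 by rewrite ge_min lexx.
have t2 : theta <= eta / 32 by rewrite ge_min lexx orbT.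
exists theta, L.+2, K0.+1; split => // K K0K.
have Kp : (0 < K)%N by apply: leq_trans K0K.
split => //.
have h1 : 4 / 2 ^+ L.+2 <= eta / 32.
  rewrite ler_pdivrMr ?exprn_gt0// 2!exprS.
  by rewrite ltr_pdivrMr// in hL; lra.
have h2 : 17 / K%:R <= eta / 32.
  rewrite ler_pdivrMr ?ltr0n//.
  have : K0%:R <= K%:R :> R by rewrite ler_nat ltnW.
  by rewrite ltr_pdivrMr// in hK; nra.
by nra.
Qed.

Lemma sum_progression_le (nu : nat -> R) (n K L : nat) :
  (forall m, 0 <= nu m) -> (0 < L)%N ->
  \sum_(k <- iota 0 K) nu (n + L * k)%N <= \sum_(n <= m < n + L * K) nu m.
Proof.
move=> nu0 L0; elim: K => [|K ih].
  by rewrite big_nil muln0 addn0 big_geq.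
rewrite -addn1 iotaD big_cat/= big_seq1 add0n addn1 mulnS.
rewrite [leRHS](@big_cat_nat _ _ _ (n + L * K)%N); [|lia|lia].
apply: lerD => //; rewrite big_ltn; last by lia.
by rewrite lerDl; exact: sumr_ge0.
Qed.

Section visits_at_scales.
Variables (a : nat -> R) (theta : R).
Hypothesis a_gt0 : forall m, 0 < a m.
Hypothesis a_le : forall m, a m ^+ 2 <= theta ^+ 2 * (2 ^ m)%:R.

Lemma wsum_visits K N L w : wsum (visits K N L) (vweight a) (vevent B a) w =
  \sum_(k <- iota 0 K) visit_count (a (N + L * k)%N) (N + L * k) w /
     gmean (a (N + L * k)%N) (N + L * k).
Proof.
rewrite /wsum /visits big_allpairs_dep/=; apply: eq_bigr => k _.
by rewrite /visit_count mulr_suml; apply: eq_bigr => i _; rewrite mulrC.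
Qed.

Lemma pr_few_visits_le K N L : (0 < K)%N -> (1 < L)%N ->
  (forall m, (N <= m)%N -> 1 <= a m * c0 * root2 m) ->
  pr P [set w | wsum (visits K N L) (vweight a) (vevent B a) w <= K%:R / 2] <=
  4 * (theta ^+ 2 + 4 / 2 ^+ L + 17 / K%:R).
Proof.
move=> K0 L1 hN; have := visits_lower_tail BM a_gt0 a_le K L1 hN.
set p := pr _ _; set D := 4 / _; move=> h.
have Kp : 0 < K%:R :> R by rewrite ltr0n.
have K2 : 0 < K%:R ^+ 2 / 4 :> R by rewrite divr_gt0// exprn_gt0.
rewrite -(ler_pM2l K2); apply: (le_trans h).
rewrite le_eqVlt; apply/orP; left; apply/eqP; field.
by rewrite gt_eqF.
Qed.

End visits_at_scales.

(** If w fails for every c, it fails for c = theta c0 / 2; then from some scale on all normalised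
    counts are at most 1/2, and w lies in every late few-visits event. As theta shrinks with eta, c
    depends on the path. The factor 1/2 in the width leaves room for the oscillation around a
    visited integer. *)
Lemma ae_visits_io (g : R) : 0 <= g -> g <= 2^-1 ->
  {ae P, forall w, exists2 c : R, 0 < c & forall N, exists2 m, (N <= m)%N &
    c * (2 ^ m)%:R `^ (2^-1 + g) <=
    visit_count (2^-1 * (2 ^ m)%:R `^ g) m w}.
Proof.
move=> g0 g1; apply: negligible_of_liminf => eta eta0.
have [theta [L [K [t0 t1 L1 hK]]]] := small_parameters eta0.
have [Kp hK'] := hK K (leqnn K).
pose a m : R := theta * (2 ^ m)%:R `^ g.
have pow_ge1 m : 1 <= (2 ^ m)%:R :> R by rewrite ler1n expn_gt0.
have a_gt0 m : 0 < a m.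
  by rewrite mulr_gt0// powR_gt0// (lt_le_trans ltr01).
have a_le m : a m ^+ 2 <= theta ^+ 2 * (2 ^ m)%:R.
  rewrite exprMn; apply: ler_wpM2l; first exact: sqr_ge0.
  rewrite -powR_mulrn ?powR_ge0// -powRrM -[leRHS]powRr1//.
  by apply: ler_powR => //; lra.
have a_ge m : theta <= a m.
  rewrite /a -{1}(mulr1 theta); apply: ler_wpM2l; first exact: ltW.
  by rewrite -[leLHS](powRr0 ((2 ^ m)%:R : R)); apply: ler_powR.
have [N0 hN0] := root2_large (mulr_gt0 t0 (@c0_gt0 R)).
exists (fun N => [set w | wsum (visits K N L) (vweight a) (vevent B a) w <=
   K%:R / 2]), N0.
split.
- move=> N; apply: wsum_measurable_le; exact: (measurable_vevent BM).
- move=> N N0N; apply: (le_trans (pr_few_visits_le a_gt0 a_le Kp L1 _)) => //.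
  move=> m Nm; apply: (le_trans (hN0 m (leq_trans N0N Nm))).
  apply: ler_wpM2r; first by rewrite ltW// root2_gt0.
  by apply: ler_wpM2r; rewrite ?a_ge// ltW// c0_gt0.
move=> w /= few; apply: contrapT => nH; apply: few.
exists (theta * c0 / 2); first by rewrite divr_gt0// mulr_gt0// c0_gt0.
move=> N; apply: contrapT => noM; apply: nH; exists N => // n /= Nn.
rewrite wsum_visits.
apply: (@le_trans _ _ (\sum_(k <- iota 0 K) 2^-1)); last first.
  by rewrite big_const_seq count_predT size_iota iter_addr_0 mulr_natl.
apply: ler_sum => k _; set m := (n + L * k)%N.
have mp := gmean_gt0 m (a_gt0 m).
rewrite ler_pdivrMr//.
apply: (@le_trans _ _ (visit_count (2^-1 * (2 ^ m)%:R `^ g) m w)).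
  apply: ler_sum => i _; rewrite !indicE ler_nat.
  case: (boolP (w \in absW B (a m) i%:R)) => // /set_mem h.
  rewrite mem_set//; apply: (le_trans h).
  by apply: ler_wpM2r; first exact: powR_ge0.
apply: (@le_trans _ _ (theta * c0 / 2 * (2 ^ m)%:R `^ (2^-1 + g))).
  rewrite leNgt; apply/negP => h; apply: noM; exists m; last exact: ltW.
  by rewrite (leq_trans Nn)// leq_addr.
rewrite -mulrA mulrCA; apply: ler_wpM2l => //.
apply: le_trans (gmean_ge _ (ltW (a_gt0 m))); rewrite /a root2E.
rewrite powRD; last by apply/implyP => _; rewrite gt_eqF// (lt_le_trans ltr01).
by rewrite le_eqVlt; apply/orP; left; apply/eqP; ring.
Qed.

(* If the covering numbers nu were summable, the tail would eventually be at
   most 1, which forces the energies to be large compared with the squared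
   numbers of visits; that has small probability on K well separated scales. *)
Lemma ae_energy_diverges (rho : R) : 0 <= rho -> rho < 2^-1 ->
  {ae P, forall w, ~ exists2 nu : nat -> R, (forall m, 0 <= nu m) &
    (forall m a lam, 0 < a -> a <= 1 -> 0 < lam ->
      visit_count a m w <= lam / 2 * nu m + visit_energy a rho m w / (2 * lam)) /\
    exists N, forall k, \sum_(N <= m < k) nu m <= 1}.
Proof.
move=> r0 r1; apply: negligible_of_liminf => eta eta0.
have eta2 : 0 < eta / 2 by rewrite divr_gt0.
have [theta [L [K0 [t0 t1 L1 hK]]]] := small_parameters eta2.
have tp : 0 < theta * c0 by rewrite mulr_gt0// c0_gt0.
pose CE : R := 2 / (theta * c0) + 16 / (2^-1 - rho).
have CE0 : 0 < CE by apply: addr_gt0; apply: divr_gt0 => //; lra.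
(* With this s the Markov threshold [c] below satisfies c / (2 s) = K / 4, and K > 2 s gives s / 2 <
   K / 4. Together they stay below K / 2, which the normalised visits exceed outside [F]. *)
have [s sE] : exists s : R, s = 4 * CE / eta by eexists.
have s0 : 0 < s by rewrite sE divr_gt0// mulr_gt0.
have [K1 hK1] := exists_nat_gt (2 * s).
pose K := maxn K0 K1.
have [Kp hK'] := hK K (leq_maxl _ _).
have Ks : 2 * s < K%:R.
  by apply: (lt_le_trans hK1); rewrite ler_nat leq_maxr.
have KR : 0 < K%:R :> R by rewrite ltr0n.
(* The width does not grow with the scale: being at most 1/2, it makes every visit at a positive
   integer a point of all level sets with g >= 0. *)
pose a (m : nat) := theta.
have a_gt0 m : 0 < a m by [].
have a_le m : a m ^+ 2 <= theta ^+ 2 * (2 ^ m)%:R.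
  by rewrite ler_peMr ?sqr_ge0// ler1n expn_gt0.
have [N0 hN0] := root2_large tp.
pose F N := [set w | wsum (visits K N L) (vweight a) (vevent B a) w <= K%:R / 2].
pose pairs N := [seq ((N + L * k)%N, p) | k <- iota 0 K,
   p <- allpairs pair (scale (N + L * k)) (scale (N + L * k))].
pose ev (x : nat * (nat * nat)) :=
  absW B theta x.2.1%:R `&` absW B theta x.2.2%:R.
pose we (x : nat * (nat * nat)) : R :=
  riesz rho x.1 (ndist x.2.1 x.2.2) / gmean theta x.1 ^+ 2.
have we0 x : 0 <= we x by rewrite divr_ge0 ?powR_ge0 ?sqr_ge0.
have mev x : measurable (ev x) by apply: measurableI; exact: (measurable_absW BM).
pose c : R := CE * K%:R / (eta / 2).
have cp : 0 < c by rewrite divr_gt0// mulr_gt0.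
pose G N := [set w | c <= wsum (pairs N) we ev w].
have mF N : measurable (F N).
  apply: wsum_measurable_le; exact: (measurable_vevent BM).
have mG N : measurable (G N) by exact: wsum_measurable_ge.
have sumK x : \sum_(k <- iota 0 K) x = K%:R * x :> R.
  by rewrite big_const_seq count_predT size_iota iter_addr_0 mulr_natl.
exists (fun N => F N `|` G N), N0; split.
- by move=> N; exact: measurableU.
- move=> N N0N; apply: (@le_trans _ _ (pr P (F N) + pr P (G N))).
    have := @pr_union_le _ _ _ P bool [:: true; false] (F N `|` G N)
      (fun b => if b then F N else G N).
    rewrite !big_cons big_nil addr0; apply.
    + exact: measurableU.
    + by case.
    + by move=> x [h|h]; [exists true|exists false].
  have -> : eta = eta / 2 + eta / 2 by field.
  apply: lerD.
    apply: le_trans hK'; apply: (pr_few_visits_le a_gt0 a_le Kp L1).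
    move=> m Nm; exact: (hN0 m (leq_trans N0N Nm)).
  have := markov_wsum P (pairs N) we0 mev (ltW cp); rewrite -/(G N) => mk.
  rewrite -(ler_pM2l cp); apply: (le_trans mk).
  have -> : c * (eta / 2) = K%:R * CE by rewrite /c divfK ?gt_eqF// mulrC.
  rewrite -sumK /pairs big_allpairs_dep/=; apply: ler_sum => k _.
  rewrite big_allpairs /we /ev/=; set m := (N + L * k)%N.
  have mp : 0 < gmean theta m by exact: gmean_gt0.
  have := energy_at_scale_le BM m t0 r0 r1; rewrite -/CE.
  rewrite -ler_pdivrMr ?exprn_gt0//; apply: le_trans.
  rewrite mulr_suml; apply: ler_sum => i _; rewrite mulr_suml.
  by apply: ler_sum => j _; rewrite mulrAC.
move=> w /= /contrapT[nu nu0 [hnu [N hN]]]; exists N => // n /= Nn.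
have [h1|h1] := leP (wsum (visits K n L) (vweight a) (vevent B a) w) (K%:R / 2).
  by left.
right; rewrite /G/= leNgt; apply/negP => h2.
pose ms k := (n + L * k)%N.
have nuK : \sum_(k <- iota 0 K) nu (ms k) <= 1.
  apply: le_trans (hN (n + L * K)%N).
  rewrite /ms; apply: (le_trans (sum_progression_le n K nu0 (ltnW L1))).
  rewrite [leRHS](big_cat_nat Nn (leq_addr _ _))/= lerDr.
  exact: sumr_ge0.
have E1 : wsum (visits K n L) (vweight a) (vevent B a) w <=
   s / 2 * \sum_(k <- iota 0 K) nu (ms k) + wsum (pairs n) we ev w / (2 * s).
  rewrite wsum_visits /wsum /pairs big_allpairs_dep/= mulr_sumr mulr_suml -big_split/=.
  apply: ler_sum => k _; rewrite -/(ms k); set m := ms k.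
  have mp : 0 < gmean theta m by exact: gmean_gt0.
  (* The free parameter is s times the mean: after division by the mean, the cover term becomes s nu
     / 2 and the energy is normalised by the squared mean. *)
  have := hnu m theta (s * gmean theta m) t0.
  rewrite mulr_gt0// => /(_ _ isT) h.
  rewrite ler_pdivrMr//; apply: le_trans (h _) _; first lra.
  rewrite [leRHS]mulrDl -/(a m); apply: lerD.
    by rewrite le_eqVlt; apply/orP; left; apply/eqP; rewrite /a; ring.
  rewrite /a big_allpairs /we /ev/= /visit_energy.
  rewrite -mulrA mulrC !mulr_suml mulr_sumr.
  rewrite le_eqVlt; apply/orP; left; apply/eqP; apply: eq_bigr => i _.
  rewrite !mulr_suml mulr_sumr; apply: eq_bigr => j _.
  by field; rewrite !gt_eqF.
have E2 : wsum (pairs n) we ev w / (2 * s) <= K%:R / 4.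
  rewrite ler_pdivrMr ?mulr_gt0//; apply: (le_trans (ltW h2)).
  by rewrite /c sE le_eqVlt; apply/orP; left; apply/eqP; field; rewrite gt_eqF.
have E3 : s / 2 * \sum_(k <- iota 0 K) nu (ms k) <= s / 2.
  by rewrite ler_piMr// ltW// divr_gt0.
by lra.
Qed.

End lower_bound_events.

(** * Covers of a shell *)

Section covers.
Context {R : realType}.
Implicit Types (E : set R) (rho : R) (Q : seq (nat * nat)).

Definition admissible n Q := forall q, q \in Q ->
  (2 ^ n.-1 <= q.1)%N /\ (q.1 < q.2)%N /\ (q.2 <= 2 ^ n)%N.

Definition covers n E Q := E `&` @Sn R n `<=`
  \bigcup_(q in [set q | q \in Q]) `[(q.1)%:R, (q.2)%:R[%classic.

Definition cover_sum n rho Q : R :=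
  \sum_(q <- Q) (((q.2 - q.1)%:R / 2 ^+ n) `^ rho).

Lemma cover_sum_ge0 n rho Q : 0 <= cover_sum n rho Q.
Proof. by apply: sumr_ge0 => q _; exact: powR_ge0. Qed.

Lemma nu_le n rho E Q : admissible n Q -> covers n E Q ->
  nu n rho E <= cover_sum n rho Q.
Proof.
move=> aQ cQ; apply: ge_inf; last by exists Q.
by exists 0 => _ [Q' [_ [_ ->]]]; exact: cover_sum_ge0.
Qed.

(** The infimum runs over a nonempty set because the whole shell is an admissible interval; at n = 0
    it would not be, since there [n.-1 = n]. *)
Lemma nu_ge n rho E x : (0 < n)%N ->
  (forall Q, admissible n Q -> covers n E Q -> x <= cover_sum n rho Q) ->
  x <= nu n rho E.
Proof.
move=> n0 h; apply: lb_le_inf; last by move=> _ [Q [aQ [cQ ->]]]; exact: h.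
exists (cover_sum n rho [:: (2 ^ n.-1, 2 ^ n)%N]), [:: (2 ^ n.-1, 2 ^ n)%N].
split; [|split => //].
- by move=> q; rewrite inE => /eqP ->; rewrite /= !leqnn ltn_exp2l// prednK.
- move=> t [_ []]; rewrite natrXE => t1 t2.
  exists (2 ^ n.-1, 2 ^ n)%N; first by rewrite /= inE.
  by rewrite /= in_itv/= t1 natrX.
Qed.

Lemma nu_ge0 n rho E : (0 < n)%N -> 0 <= nu n rho E.
Proof. by move=> n0; apply: nu_ge => // Q _ _; exact: cover_sum_ge0. Qed.

Lemma Sn_scaleP n t : (0 < n)%N -> @Sn R n t ->
  0 <= t /\ Num.truncn t \in scale n.-1.
Proof.
move=> n0 [+ t2]; rewrite natrXE => t1.
have t0 : 0 <= t by apply: le_trans t1.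
have /andP[k1 k2] : (Num.truncn t)%:R <= t < (Num.truncn t).+1%:R := truncn_itv t0.
split => //; rewrite scaleP prednK//; apply/andP; split.
  by rewrite -ltnS -(@ltr_nat R); apply: le_lt_trans k2.
by rewrite -(@ltr_nat R) natrX; apply: le_lt_trans k1 _.
Qed.

(** S_n is 2^m times S_(n-m), so its cells of length 2^m are numbered by [scale (n.-1 - m)]. *)
Lemma nu_le_cells n m rho E (h : pred nat) : (m < n)%N ->
  (forall i t, i \in scale (n.-1 - m) -> E t ->
     (i * 2 ^ m)%:R <= t -> t < (i.+1 * 2 ^ m)%:R -> h i) ->
  nu n rho E <= (count h (scale (n.-1 - m)))%:R * (2 ^+ m / 2 ^+ n) `^ rho.
Proof.
move=> mn hE.
have n0 : (0 < n)%N by apply: leq_ltn_trans mn.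
have nm : (n.-1 = (n.-1 - m) + m)%N by lia.
pose Q := [seq (i * 2 ^ m, i.+1 * 2 ^ m)%N | i <- seq.filter h (scale (n.-1 - m))].
apply: (@le_trans _ _ (cover_sum n rho Q)); last first.
  rewrite /cover_sum /Q big_map.
  under eq_bigr do rewrite /= mulSn addnK natrX.
  by rewrite big_const_seq count_predT size_filter iter_addr_0 mulr_natl.
apply: nu_le.
- move=> q /mapP[i]; rewrite mem_filter scaleP => /andP[_ /andP[i1 i2]] -> /=.
  rewrite ltn_pmul2r ?expn_gt0// ltnSn; split; [|split => //].
    by rewrite nm expnD leq_pmul2r// expn_gt0.
  rewrite -(prednK n0) nm -addSn expnD leq_pmul2r// ?expn_gt0//.
- move=> t [Et /(Sn_scaleP n0)[t0]].
  set k := Num.truncn t; rewrite scaleP => /andP[k1 k2].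
  have /andP[kt tk] : k%:R <= t < k.+1%:R := truncn_itv t0.
  pose i := (k %/ 2 ^ m)%N.
  have ik : (i * 2 ^ m <= k)%N := leq_trunc_div _ _.
  have ki : (k.+1 <= i.+1 * 2 ^ m)%N by rewrite ltn_ceil// expn_gt0.
  have iscale : i \in scale (n.-1 - m).
    rewrite scaleP /i leq_divRL ?expn_gt0// ltn_divLR ?expn_gt0//.
    by rewrite -!expnD addSn -nm k1 k2.
  have it : (i * 2 ^ m)%:R <= t by apply: le_trans kt; rewrite ler_nat.
  have ti : t < (i.+1 * 2 ^ m)%:R by apply: lt_le_trans tk _; rewrite ler_nat.
  exists (i * 2 ^ m, i.+1 * 2 ^ m)%N; last by rewrite /= in_itv/= it.
  by apply: map_f; rewrite mem_filter iscale (hE i t).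
Qed.

(* The covering intervals may overlap: each visited point is assigned to the
   first interval containing it, and a pair of points sharing an interval of
   length l is at distance less than l. *)
Lemma visits_le_energy m rho rho' lam (V : pred nat) Q : 0 <= rho ->
  rho <= rho' -> 0 < lam -> admissible m.+1 Q ->
  (forall i, i \in scale m -> V i -> exists2 q, q \in Q & (q.1 <= i < q.2)%N) ->
  \sum_(i <- scale m) (V i)%:R <= lam / 2 * cover_sum m.+1 rho Q +
    (\sum_(i <- scale m) \sum_(j <- scale m)
      riesz rho' m (ndist i j) * (V i && V j)%:R) / (2 * lam).
Proof.
move=> r0 rr lam0 aQ cV.
(* Index of the first interval containing i, and [size Q] if there is none. *)
pose ix (i : nat) := find (fun q : nat * nat => (q.1 <= i < q.2)%N) Q.
pose q_ k := nth (0%N, 0%N) Q k.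
pose w k : R := ((((q_ k).2 - (q_ k).1)%:R / 2 ^+ m.+1) `^ rho).
pose x k i : R := (V i && (ix i == k))%:R.
have ixV i : i \in scale m -> V i -> (ix i < size Q)%N.
  move=> im Vi; have [q qQ qi] := cV i im Vi.
  by rewrite -has_find; apply/hasP; exists q.
have sumx i : i \in scale m -> \sum_(0 <= k < size Q) x k i = (V i)%:R.
  move=> im; rewrite /x; case Vi : (V i); last by rewrite big1.
  rewrite (big_rem (ix i)) ?mem_index_iota ?ixV//= eqxx big_seq big1 ?addr0//.
  move=> k; rewrite (rem_filter _ (iota_uniq _ _)) mem_filter => /andP[/= ki _].
  by rewrite eq_sym (negbTE ki).
have xx i j : i \in scale m -> \sum_(0 <= k < size Q) x k i * x k j <= (V i && V j)%:R.
  move=> im; apply: (@le_trans _ _ (\sum_(0 <= k < size Q) x k i * (V j)%:R)).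
    apply: ler_sum => k _; apply: ler_wpM2l; first exact: ler0n.
    by rewrite /x ler_nat; case: (V j) => //; exact: leq_b1.
  by rewrite -mulr_suml sumx// -natrM mulnb.
have -> : \sum_(i <- scale m) (V i)%:R =
    \sum_(0 <= k < size Q) \sum_(i <- scale m) x k i.
  by rewrite exchange_big/= big_seq [RHS]big_seq; apply: eq_bigr => i im; rewrite sumx.
have -> : cover_sum m.+1 rho Q = \sum_(0 <= k < size Q) w k.
  by rewrite /cover_sum (big_nth (0%N, 0%N)).
apply: (@le_trans _ _ (\sum_(0 <= k < size Q) (lam / 2 * w k +
   (\sum_(i <- scale m) \sum_(j <- scale m)
     riesz rho' m (ndist i j) * (x k i * x k j)) / (2 * lam)))).
  rewrite big_seq [leRHS]big_seq; apply: ler_sum => k; rewrite mem_index_iota/= => kQ.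
  set X := \sum_(_ <- _) _.
  have [_ [q12 q2]] := aQ _ (mem_nth (0%N, 0%N) kQ).
  have l0 : 0 < ((q_ k).2 - (q_ k).1)%:R :> R by rewrite ltr0n subn_gt0.
  have w0 : 0 < w k by rewrite powR_gt0// divr_gt0// exprn_gt0.
  (* Two points of interval k are at distance at most l - 1, with l its length, so the kernel
     dominates (2^(m+1) / l)^rho = 1 / [w k] for each pair. *)
  have key : X ^+ 2 / w k <= \sum_(i <- scale m) \sum_(j <- scale m)
     riesz rho' m (ndist i j) * (x k i * x k j).
    rewrite expr2 /X big_distrlr/= mulr_suml.
    rewrite big_seq [leRHS]big_seq; apply: ler_sum => i im.
    rewrite mulr_suml big_seq [leRHS]big_seq; apply: ler_sum => j jm.
    rewrite mulrC; rewrite /x.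
    case Vi : (V i); last by rewrite /= mul0r !mulr0.
    case Vj : (V j); last by rewrite /= mulr0 !mulr0.
    case: (eqVneq (ix i) k) => [ixk|]; last by rewrite /= mul0r !mulr0.
    case: (eqVneq (ix j) k) => [jxk|]; last by rewrite /= mulr0 !mulr0.
    rewrite /= !mulr1.
    have inq i' : i' \in scale m -> V i' -> ix i' = k -> ((q_ k).1 <= i' < (q_ k).2)%N.
      move=> im' Vi' <-; apply: (nth_find (0%N, 0%N)
        (a := fun q : nat * nat => (q.1 <= i' < q.2)%N)).
      by rewrite has_find ixV.
    have /andP[i1 i2] := inq i im Vi ixk.
    have /andP[j1 j2] := inq j jm Vj jxk.
    have dl : ((ndist i j).+1 <= (q_ k).2 - (q_ k).1)%N by rewrite /ndist; lia.
    have d0 : 0 < (ndist i j).+1%:R :> R by rewrite ltr0n.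
    rewrite /w -powRN /riesz.
    have -> : ((((q_ k).2 - (q_ k).1)%:R / 2 ^+ m.+1) `^ (- rho)) =
      (2 ^+ m.+1 / ((q_ k).2 - (q_ k).1)%:R) `^ rho :> R.
      by rewrite -(mulN1r rho) powRrM powR_inv1 ?invf_div.
    have p0 : 0 < 2 ^+ m.+1 :> R by rewrite exprn_gt0.
    apply: (@le_trans _ _ ((2 ^+ m.+1 / (ndist i j).+1%:R) `^ rho)).
      apply: ge0_ler_powR => //; rewrite ?nnegrE ?divr_ge0 ?(ltW p0)//.
      apply: ler_wpM2l; first exact: ltW.
      by rewrite lef_pV2 ?posrE// ler_nat.
    (* The distance plus one is at most the length of the interval, hence at most 2^(m+1). The base
       is thus at least 1 and the exponent may grow to [rho'], later chosen rational. *)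
    apply: ler_powR => //; rewrite ler_pdivlMr// mul1r -natrX ler_nat.
    by apply: (leq_trans dl); apply: leq_trans q2; exact: leq_subr.
  (* The inequality 2 X (lam w) <= (lam w)^2 + X^2, divided by 2 lam w. *)
  have am : X <= lam / 2 * w k + X ^+ 2 / w k / (2 * lam).
    have lw : 0 < lam * w k by rewrite mulr_gt0.
    have -> : lam / 2 * w k + X ^+ 2 / w k / (2 * lam) =
      X + (lam * w k - X) ^+ 2 / (2 * (lam * w k)).
      by field; rewrite !gt_eqF.
    by rewrite lerDl divr_ge0 ?sqr_ge0// mulr_ge0// ltW.
  apply: (le_trans am); rewrite lerD2l; apply: ler_wpM2r => //.
  by rewrite invr_ge0 mulr_ge0// ltW.
rewrite big_split/= -mulr_sumr lerD2l -mulr_suml; apply: ler_wpM2r.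
  by rewrite invr_ge0 mulr_ge0// ltW.
rewrite exchange_big/= big_seq [leRHS]big_seq; apply: ler_sum => i im.
rewrite exchange_big/=; apply: ler_sum => j _.
by rewrite -mulr_sumr; apply: ler_wpM2l; [exact: powR_ge0|exact: xx].
Qed.

(** Relative lengths are at most 1, so raising them to a power rho <= 1 does not decrease them, and
    an interval of length l contains at most l integers. *)
Lemma visits_le_length m rho (V : pred nat) Q : rho <= 1 ->
  admissible m.+1 Q ->
  (forall i, i \in scale m -> V i -> exists2 q, q \in Q & (q.1 <= i < q.2)%N) ->
  (\sum_(i <- scale m) (V i)%:R) / 2 ^+ m.+1 <= cover_sum m.+1 rho Q.
Proof.
move=> r1 aQ cV; rewrite ler_pdivrMr ?exprn_gt0//.
apply: (@le_trans _ _ (\sum_(q <- Q) (q.2 - q.1)%:R)); last first.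
  rewrite /cover_sum mulr_suml big_seq [leRHS]big_seq; apply: ler_sum => q qQ.
  have [_ [q12 q2]] := aQ _ qQ.
  rewrite -ler_pdivrMr ?exprn_gt0//.
  set y := _ / _.
  have y0 : 0 < y by rewrite divr_gt0 ?exprn_gt0// ltr0n subn_gt0.
  have y1 : y <= 1.
    rewrite ler_pdivrMr ?exprn_gt0// mul1r -natrX ler_nat.
    by apply: leq_trans q2; exact: leq_subr.
  rewrite -[leLHS]powRr1 ?(ltW y0)//.
  by rewrite /powR gt_eqF// ler_expR ler_wnM2r// ln_le0.
apply: (@le_trans _ _ (\sum_(i <- scale m) \sum_(q <- Q) (q.1 <= i < q.2)%N%:R)).
  rewrite big_seq [leRHS]big_seq; apply: ler_sum => i im.
  case Vi : (V i); last by apply: sumr_ge0.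
  have [q qQ qi] := cV i im Vi.
  by rewrite (big_rem q)//= qi lerDl; apply: sumr_ge0.
rewrite exchange_big/= big_seq [leRHS]big_seq; apply: ler_sum => q qQ.
rewrite -natr_sum ler_nat.
have -> : (\sum_(i <- scale m) (q.1 <= i < q.2))%N =
    count (fun i => q.1 <= i < q.2)%N (scale m).
  by rewrite -sum1_count [RHS]big_mkcond; apply: eq_bigr => i _; case: ifP.
have [_ [/ltnW q12 _]] := aQ _ qQ.
rewrite -size_filter -[leqRHS](size_iota q.1); apply: uniq_leq_size.
  by rewrite filter_uniq// iota_uniq.
by move=> i; rewrite mem_filter mem_iota subnKC// => /andP[].
Qed.

End covers.

(** * Summability criteria for the dimension *)

Section dimension_criteria.
Context {R : realType}.
Implicit Types (u : nat -> R) (E : set R) (rho q : R).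

Let partial u n := (\sum_(1 <= m < n) (u m)%:E)%E.

Let partialE u n : partial u n = (\sum_(1 <= m < n) u m)%:E.
Proof. by rewrite /partial sumEFin. Qed.

Let nd_partial u : (forall m, 0 <= u m.+1) ->
  {homo (fun n => \sum_(1 <= m < n) u m) : a b / (a <= b)%N >-> a <= b}.
Proof.
move=> u0; apply: homo_leq => // [x y z|n]; first exact: le_trans.
case: n => [|n]; first by rewrite !big_geq.
by rewrite [leRHS]big_nat_recr//= lerDl.
Qed.

Let series_sup u : (forall m, 0 <= u m.+1) ->
  (\sum_(1 <= m <oo) (u m)%:E)%E = ereal_sup (range (partial u)).
Proof.
move=> u0; apply/cvg_lim => //; apply: ereal_nondecreasing_cvgn => a b ab.
by rewrite -!/(partial u _) !partialE lee_fin nd_partial.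
Qed.

Lemma series_ltyP u : (forall m, 0 <= u m.+1) ->
  (exists M, forall k, \sum_(1 <= m < k) u m <= M) ->
  (\sum_(1 <= m <oo) (u m)%:E < +oo)%E.
Proof.
move=> u0 [M hM]; rewrite series_sup//.
apply: (@le_lt_trans _ _ M%:E); last exact: ltry.
by apply: ub_ereal_sup => _ [k _ <-]; rewrite partialE lee_fin.
Qed.

(** The shift to [u m.+1] numbers the terms by scale instead of by shell. *)
Lemma series_lty_tail u : (forall m, 0 <= u m.+1) ->
  (\sum_(1 <= m <oo) (u m)%:E < +oo)%E ->
  forall e : R, 0 < e -> exists N, forall k, \sum_(N <= m < k) u m.+1 <= e.
Proof.
move=> u0; rewrite series_sup//; set S := ereal_sup _ => Soo e e0.
have ub k : (partial u k <= S)%E by apply: ereal_sup_ubound; exists k.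
have S0 : (0 <= S)%E by have := ub 1%N; rewrite /partial big_geq.
have Sfin : S = (fine S)%:E by rewrite fineK// ge0_fin_numE.
have : ((fine S - e)%:E < S)%E by rewrite {2}Sfin lte_fin ltrBlDr ltrDl.
move=> /ereal_sup_gt[_ [N _ <-]]; rewrite partialE lte_fin => hN.
exists N => k; rewrite -(big_add1 _ _ N k.+1 xpredT u).
have [kN|Nk] := leqP k.+1 N.+1; first by rewrite big_geq// ltW.
have := ub k.+1; rewrite partialE Sfin lee_fin.
case: N hN Nk => [|N] hN Nk.
  rewrite big_geq in hN => //; move=> h; apply: (le_trans h).
  by lra.
rewrite (@big_cat_nat _ _ _ N.+2)//=; last exact: ltnW.
rewrite (@big_nat_recr _ _ _ N.+1)//=.
have := u0 N; lra.
Qed.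

Lemma geometric_bounded u N (C q : R) : (forall m, 0 <= u m.+1) ->
  0 <= C -> 0 <= q -> q < 1 -> (forall n, (N <= n)%N -> u n <= C * q ^+ n) ->
  exists M, forall k, \sum_(1 <= m < k) u m <= M.
Proof.
move=> u0 C0 q0 q1 h.
exists (\sum_(1 <= m < N.+1) u m + C / (1 - q)) => k.
have geo j : \sum_(0 <= m < j) q ^+ m <= (1 - q)^-1.
  rewrite -[leRHS]mul1r ler_pdivlMr ?subr_gt0//.
  have -> : (\sum_(0 <= m < j) q ^+ m) * (1 - q) = 1 - q ^+ j.
    elim: j => [|j ih]; first by rewrite big_geq// mul0r expr0 subrr.
    by rewrite big_nat_recr//= mulrDl ih exprS; ring.
  by rewrite gerBl exprn_ge0.
apply: (@le_trans _ _ (\sum_(1 <= m < N.+1) u m + C * \sum_(0 <= m < k) q ^+ m)); last first.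
  by rewrite lerD2l; apply: ler_wpM2l.
have [kN|] := leqP k N.+1.
  apply: (le_trans (nd_partial u0 kN)); rewrite lerDl mulr_ge0//.
  by apply: sumr_ge0 => m _; rewrite exprn_ge0.
have geo0 j : 0 <= C * \sum_(0 <= m < j) q ^+ m.
  by rewrite mulr_ge0//; apply: sumr_ge0 => m _; rewrite exprn_ge0.
elim: k => // k ih; rewrite ltnS => Nk.
have {}ih : \sum_(1 <= m < k) u m <=
    \sum_(1 <= m < N.+1) u m + C * \sum_(0 <= m < k) q ^+ m.
  by move: Nk; rewrite leq_eqVlt => /predU1P[<-|/ih//]; rewrite lerDl.
rewrite big_nat_recr/=; last by apply: leq_trans Nk.
rewrite (@big_nat_recr _ _ _ k 0%N)//= mulrDr addrA; apply: lerD => //.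
by apply: h; exact: ltnW.
Qed.

Lemma DimH_le E rho0 : 0 <= rho0 ->
  (forall rho, rho0 < rho -> exists M, forall k, \sum_(1 <= m < k) nu m rho E <= M) ->
  (DimH E <= rho0%:E)%E.
Proof.
move=> r0 h; apply/lee_addgt0Pr => e e0; rewrite -EFinD.
apply: ereal_inf_lbound; exists (rho0 + e) => //; split.
  by rewrite addr_ge0// ltW.
apply: series_ltyP; first by move=> m; exact: nu_ge0.
by apply: h; rewrite ltrDl.
Qed.

Lemma DimH_ge E rho0 :
  (forall rho, 0 <= rho -> rho < rho0 ->
    ~ (forall e : R, 0 < e -> exists N, forall k,
         \sum_(N <= m < k) nu m.+1 rho E <= e)) ->
  (rho0%:E <= DimH E)%E.
Proof.
move=> h; apply: le_ereal_inf_tmp => _ [rho [r0 hr] <-].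
rewrite lee_fin leNgt; apply/negP => lt; apply: (h rho r0 lt).
by apply: (@series_lty_tail (fun m => nu m rho E)) => // m; exact: nu_ge0.
Qed.

End dimension_criteria.

(** * Counting visited dyadic cells *)

Section upper_bound_events.
Context {R : realType} {d : measure_display} {T : measurableType d}.
Variables (P : probability T R) (B : R -> T -> R).
Hypothesis BM : brownian_motion P B.
Local Notation c0 := (@c0 R).

Definition grid_count (a : R) n m w : R :=
  wsum (iota 0 (2 ^ (n - m))) (fun=> 1) (fun i => absW B a (i * 2 ^ m)%:R) w.

(** The cell at the origin contributes at most 1, the cell i > 0 at most 2 a c0 / sqrt(i 2^m).
    Summing the inverse square roots over 2^(n-m) cells and using c0 <= 1 gives the second term. *)
Lemma grid_count_expected a n m : 0 <= a -> (m <= n)%N ->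
  \sum_(i <- iota 0 (2 ^ (n - m))) 1 * pr P (absW B a (i * 2 ^ m)%:R) <=
  1 + 4 * a * root2 n / 2 ^+ m.
Proof.
move=> a0 mn; set M := (2 ^ (n - m))%N.
have M0 : (0 < M)%N by rewrite expn_gt0.
rewrite -(prednK M0)/= big_cons mul0n mul1r; apply: lerD.
  by rewrite -lee_fin -prE ?probability_le1//; exact: (measurable_absW BM).
have rm := @root2_gt0 R m.
apply: (@le_trans _ _ (\sum_(0 <= i < M.-1)
    2 * a * c0 / root2 m * (Num.sqrt i.+1%:R)^-1)).
  rewrite -[1%N](addn0 1) iotaDl big_map /index_iota subn0.
  apply: ler_sum => i _; rewrite mul1r add1n.
  have i0 : 0 < (i.+1 * 2 ^ m)%:R :> R by rewrite ltr0n muln_gt0 expn_gt0.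
  apply: (le_trans (pr_absW_le BM i0 a0)).
  rewrite natrM sqrtrM// -/(root2 m) invfM.
  by rewrite le_eqVlt; apply/orP; left; apply/eqP; ring.
rewrite -mulr_sumr.
have cp := @c0_gt0 R; have c1 := @c0_le1 R.
have x0 : 0 <= 2 * a * c0 / root2 m by rewrite divr_ge0 ?mulr_ge0 ?(ltW cp) ?(ltW rm).
apply: (le_trans (ler_wpM2l x0 (sum_inv_sqrt_le _))).
have rnE : root2 n = root2 m * root2 (n - m) :> R.
  by rewrite /root2 -sqrtrM// -natrM -expnD subnKC.
have s1 : Num.sqrt M.-1%:R <= root2 (n - m) :> R.
  by apply: ler_wsqrtr; rewrite ler_nat leq_pred.
apply: (@le_trans _ _ (2 * a * c0 / root2 m * (2 * root2 (n - m)))).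
  by apply: ler_wpM2l => //; apply: ler_wpM2l.
rewrite rnE -natrX -root2_sqr.
have -> : 4 * a * (root2 m * root2 (n - m)) / root2 m ^+ 2 =
  4 * a * 1 * (root2 (n - m) / root2 m).
  by field; rewrite gt_eqF.
have -> : 2 * a * c0 / root2 m * (2 * root2 (n - m)) =
  4 * a * c0 * (root2 (n - m) / root2 m) by ring.
apply: ler_wpM2r; first by rewrite divr_ge0 ?(ltW rm)// ltW// root2_gt0.
by apply: ler_wpM2l; rewrite ?mulr_ge0.
Qed.

(** Giving away a factor 2^(n e) in Markov's inequality leaves exceedance probabilities 2^(-n e), a
    geometric sequence. *)
Lemma ae_grid_count_le (m : nat -> nat) (a : nat -> R) (e : R) :
  (forall n, (m n <= n)%N) -> (forall n, 0 <= a n) -> 0 < e ->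
  {ae P, forall w, exists N, forall n, (N <= n)%N ->
    grid_count (a n) n (m n) w <=
    2 `^ (n%:R * e) * (1 + 4 * a n * root2 n / 2 ^+ m n)}.
Proof.
move=> mn a0 e0.
pose D n := 1 + 4 * a n * root2 n / 2 ^+ m n.
have D0 n : 0 < D n.
  by rewrite ltr_pwDl// divr_ge0 ?exprn_ge0// !mulr_ge0// ltW// root2_gt0.
have t0 n : 0 < 2 `^ (n%:R * e) :> R by rewrite powR_gt0.
pose A n := [set w | 2 `^ (n%:R * e) * D n <= grid_count (a n) n (m n) w].
have mA n : measurable (A n).
  by apply: wsum_measurable_ge => i; exact: (measurable_absW BM).
pose q : R := 2 `^ (- e).
have q0 : 0 <= q by exact: powR_ge0.
have q1 : q < 1.
  rewrite /q powRN invf_lt1 ?powR_gt0// /powR gt_eqF//.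
  by rewrite expR_gt1 mulr_gt0// ln_gt0 ?ltr1n.
have le n : pr P (A n) <= 1 * q ^+ n.
  have c0' : 0 <= 2 `^ (n%:R * e) * D n by rewrite ltW// mulr_gt0.
  have := @markov_wsum _ _ _ P _ (iota 0 (2 ^ (n - m n))) (fun=> 1)
    (fun i => absW B (a n) (i * 2 ^ m n)%:R) _ (fun=> ler01)
    (fun i => measurable_absW BM (a n) (ler0n _ _)) c0'.
  rewrite -/(grid_count _ _ _ _) => h.
  have := le_trans h (grid_count_expected (a0 n) (mn n)).
  rewrite -/(D n) mulrAC -ler_pdivlMr// divff ?gt_eqF// => h1.
  rewrite mul1r -powR_mulrn// -powRrM mulrC mulrN powRN.
  by rewrite -[leRHS]mul1r ler_pdivlMr// mulrC.
have := borel_cantelli_geometric mA q0 q1 le.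
apply: filterS => w [N hN]; exists N => n Nn.
by rewrite leNgt; apply/negP => h; apply: (hN n Nn); exact: ltW.
Qed.

End upper_bound_events.

(** * Logarithmic growth rates, Lebesgue measure and pixels *)

Section growth_exponents.
Context {R : realType}.
Implicit Types (u : (\bar R)^nat) (L s : R) (E F : set R).

Lemma limn_esup_le_near u L : (forall e : R, 0 < e -> exists N, forall n,
    (N <= n)%N -> (u n <= (L + e)%:E)%E) -> (limn_esup u <= L%:E)%E.
Proof.
move=> h; apply/lee_addgt0Pr => e e0; rewrite -EFinD.
have [N hN] := h e e0.
apply: ge_ereal_inf; exists (ereal_sup (u @` [set n | (N <= n)%N])).
  by exists [set n | (N <= n)%N] => //; exists N.
by apply: ge_ereal_sup => _ [n /= Nn <-]; exact: hN.
Qed.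

Lemma limn_esup_ge_often u L : (forall (e : R) N, 0 < e -> exists2 n,
    (N <= n)%N & ((L - e)%:E <= u n)%E) -> (L%:E <= limn_esup u)%E.
Proof.
move=> h; apply: le_ereal_inf_tmp => _ [V [N _ NV] <-].
apply/lee_subgt0Pr => e e0; rewrite -EFinB.
have [n Nn hn] := h e N e0; apply: (le_trans hn).
by apply: ereal_sup_ubound; exists n => //; exact: NV.
Qed.

Lemma ln2_gt0 : 0 < ln (2 : R).
Proof. by rewrite ln_gt0 ?ltr1n. Qed.

Lemma log2e_le (x : \bar R) n s : (0 < n)%N -> (0 <= x)%E ->
  (x <= (2 `^ (n%:R * s))%:E)%E -> (log2e x * (n%:R^-1)%:E <= s%:E)%E.
Proof.
move=> n0; have nR : 0 < n%:R :> R by rewrite ltr0n.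
case: x => [r||]//; rewrite !lee_fin => r0 h.
rewrite /log2e; have [_|rn0] := eqVneq r 0.
  by rewrite mulNyr gtr0_sg ?invr_gt0// mul1e leNye.
have rp : 0 < r by rewrite lt_neqAle eq_sym rn0.
rewrite -EFinM lee_fin ler_pdivrMr// ler_pdivrMr ?ln2_gt0//.
have := h; rewrite -ler_ln ?posrE ?powR_gt0// ln_powR => h'.
by apply: (le_trans h'); rewrite (mulrC s).
Qed.

Lemma log2e_ge (x : \bar R) n s : (0 < n)%N ->
  ((2 `^ (n%:R * s))%:E <= x)%E -> (s%:E <= log2e x * (n%:R^-1)%:E)%E.
Proof.
move=> n0; have nR : 0 < n%:R :> R by rewrite ltr0n.
have p0 : 0 < 2 `^ (n%:R * s) :> R by rewrite powR_gt0.
case: x => [r||]//; last first.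
  by move=> _; rewrite /log2e mulyr gtr0_sg ?invr_gt0// mul1e leey.
rewrite lee_fin => h; have rp : 0 < r by exact: lt_le_trans h.
rewrite /log2e gt_eqF// -EFinM lee_fin ler_pdivlMr// ler_pdivlMr ?ln2_gt0//.
have := h; rewrite -ler_ln ?posrE// ln_powR => h'.
by apply: le_trans h'; rewrite (mulrC s).
Qed.

(** 2^(n e) is the square of exp(n y): one factor beats z (n + 1), the other C / z. *)
Lemma linear_le_exp (C e : R) : 0 < e ->
  exists N, forall n, (N <= n)%N -> C * n.+1%:R <= 2 `^ (n%:R * e).
Proof.
move=> e0; pose y := e * ln 2 / 2.
have y0 : 0 < y by rewrite divr_gt0// mulr_gt0// ln2_gt0.
pose z := Num.min 1 y.
have z0 : 0 < z by rewrite lt_min ltr01.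
have z1 : z <= 1 by rewrite ge_min lexx.
have zy : z <= y by rewrite ge_min lexx orbT.
have [N hN] := exists_nat_gt (C / z / y).
exists N => n Nn; have nR : 0 <= n%:R :> R by [].
have h1 : z * n.+1%:R <= 1 + n%:R * y by rewrite -natr1; nra.
have h2 : C / z <= 1 + n%:R * y.
  have : C / z / y <= n%:R by rewrite (le_trans (ltW hN))// ler_nat.
  by rewrite ler_pdivrMr//; lra.
have -> : 2 `^ (n%:R * e) = expR (n%:R * y) * expR (n%:R * y) :> R.
  by rewrite -expRD /powR gt_eqF//; congr expR; rewrite /y; field.
have h3 : 1 + n%:R * y <= expR (n%:R * y) by exact: expR_ge1Dx.
apply: (@le_trans _ _ ((C / z) * (z * n.+1%:R))).
  by rewrite mulrA divfK ?gt_eqF.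
have zn : 0 <= z * n.+1%:R by rewrite mulr_ge0// ltW.
apply: (@le_trans _ _ ((1 + n%:R * y) * (z * n.+1%:R))); first exact: ler_wpM2r.
apply: ler_pM => //; last exact: le_trans h3.
by rewrite addr_ge0// mulr_ge0// ltW.
Qed.

Let mu := @lebesgue_measure R.

Let measure_slab F a k : measurable F ->
  mu (F `&` `[a%:R, (a + k.+1)%:R[) = (mu (F `&` `[a%:R, (a + k)%:R[) +
     mu (F `&` `[(a + k)%:R, (a + k).+1%:R[))%E.
Proof.
move=> mF; rewrite -measureU.
- rewrite -setIUr; congr (mu (F `&` _)); rewrite addnS.
  have ak : a%:R <= (a + k)%:R :> R by rewrite ler_nat leq_addr.
  have kk : (a + k)%:R <= (a + k).+1%:R :> R by rewrite ler_nat.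
  apply/seteqP; split => t /=; rewrite !in_itv/=.
    move=> /andP[t1 t2]; have [tk|kt] := ltP t (a + k)%:R; first by left; rewrite t1.
    by right.
  by move=> [] /andP[t1 t2]; apply/andP; split => //;
    [exact: lt_le_trans kk|exact: le_trans t1].
- exact: measurableI.
- exact: measurableI.
- rewrite -subset0 => t [[_ /=]]; rewrite !in_itv/= => /andP[_ t1] [_ /andP[t2 _]].
  by have := lt_le_trans t1 t2; rewrite ltxx.
Qed.

Lemma lebesgue_le_count F (h : pred nat) a k : measurable F ->
  (forall i t, (a <= i < a + k)%N -> F t -> i%:R <= t -> t < i.+1%:R -> h i) ->
  (mu (F `&` `[a%:R, (a + k)%:R[) <= (count h (iota a k))%:R%:E)%E.
Proof.
move=> mF; elim: k => [_|k ih hF].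
  suff -> : F `&` `[a%:R, (a + 0)%:R[ = set0 by rewrite /mu measure0.
  rewrite -subset0 => t [_ /=].
  by rewrite addn0 in_itv/= => /andP[t1 /(le_lt_trans t1)]; rewrite ltxx.
have -> : iota a k.+1 = iota a k ++ [:: (a + k)%N] by rewrite -addn1 iotaD.
rewrite measure_slab// count_cat (natrD R (count h (iota a k))) EFinD.
apply: leeD.
  by apply: ih => i t ik; apply: hF; lia.
rewrite /= addn0; case hk : (h (a + k)%N) => /=.
  apply: (@le_trans _ _ (mu `[(a + k)%:R, (a + k).+1%:R[)).
    by apply: le_measure; rewrite ?inE//; exact: measurableI.
  by rewrite /mu lebesgue_measure_itv/= lte_fin ltr_nat ltnSn -EFinB -natr1 addrAC subrr add0r.
suff -> : F `&` `[(a + k)%:R, (a + k).+1%:R[ = set0 by rewrite /mu measure0.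
rewrite -subset0 => t [Ft /=]; rewrite in_itv/= => /andP[t1 t2].
by move: hk; rewrite (hF (a + k)%N t)//; lia.
Qed.

(** Since del <= 1, the intervals [i, i + del) stay in their own unit slabs and their lengths add
    up. *)
Lemma lebesgue_ge_count F (h : pred nat) (del : R) a k : measurable F ->
  0 < del -> del <= 1 ->
  (forall i, (a <= i < a + k)%N -> h i -> `[i%:R, i%:R + del[%classic `<=` F) ->
  ((del * (count h (iota a k))%:R)%:E <= mu (F `&` `[a%:R, (a + k)%:R[))%E.
Proof.
move=> mF d0 d1; elim: k => [_|k ih hF]; first by rewrite mulr0.
have -> : iota a k.+1 = iota a k ++ [:: (a + k)%N] by rewrite -addn1 iotaD.
rewrite measure_slab// count_cat (natrD R (count h (iota a k))) mulrDr EFinD.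
apply: leeD.
  by apply: ih => i ik; apply: hF; lia.
rewrite /= addn0; case hk : (h (a + k)%N) => /=; last by rewrite mulr0.
apply: (@le_trans _ _ (mu `[(a + k)%:R, (a + k)%:R + del[)).
  rewrite /mu lebesgue_measure_itv/= lte_fin ltrDl d0 -EFinB mulr1.
  by rewrite addrAC subrr add0r.
apply: le_measure; rewrite ?inE//; first exact: measurableI.
move=> t tk; split; first by apply: (hF (a + k)%N) => //; lia.
move: tk; rewrite /= !in_itv/= => /andP[-> t2] /=.
by apply: (lt_le_trans t2); rewrite -natr1 lerD2l.
Qed.

Lemma ecard_le (S S' : set int) : S `<=` S' -> (@ecard R S <= @ecard R S')%E.
Proof.
move=> SS'; apply: ge_ereal_sup => _ [X [finX XS] <-]; apply: esum_ge.
by exists X => //; split => //; exact: subset_trans SS'.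
Qed.

Lemma ecard_seq (r : seq int) : uniq r -> @ecard R [set` r] = (size r)%:R%:E.
Proof.
move=> ur; rewrite /ecard esum_fset//; last exact: finite_seq.
rewrite -fsbig_seq// (eq_bigr (fun=> 1%:E))// sumEFin.
by rewrite big_const_seq count_predT iter_addr_0.
Qed.

Lemma ecard_ge0 (S : set int) : (0 <= @ecard R S)%E.
Proof. by apply: esum_ge0. Qed.

(** A point of [i, i+1) has its pixels among i - 1, i, i + 1, i + 2, hence the factor 4. *)
Lemma ecard_pix_le F (h : pred nat) N : F `<=` `[0, N%:R[%classic ->
  (forall i t, (i < N)%N -> F t -> i%:R <= t -> t < i.+1%:R -> h i) ->
  (@ecard R (pix F) <= (4 * (count h (iota 0 N))%:R)%:E)%E.
Proof.
move=> FN hF.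
pose r := flatten [seq [:: i%:Z - 1; i%:Z; i%:Z + 1; i%:Z + 2] |
   i <- seq.filter h (iota 0 N)].
have sr : (size r <= 4 * count h (iota 0 N))%N.
  rewrite -size_filter /r; elim: (seq.filter _ _) => //= i l; lia.
apply: (@le_trans _ _ (@ecard R [set` undup r])); last first.
  rewrite ecard_seq ?undup_uniq// lee_fin -natrM ler_nat.
  by apply: leq_trans sr; exact: size_undup.
apply: ecard_le => x xF /=; rewrite mem_undup.
(* Tolerance 1/2 suffices for integers: |x - t| < 3/2 and i <= t < i + 1 force i - 2 < x < i + 3. *)
have e0 : 0 < 2^-1 :> R by lra.
have [t [Ft xt]] := xF 2^-1 e0.
have := FN t Ft; rewrite /= in_itv/= => /andP[t0 tN].
pose i := Num.truncn t.
have /andP[it ti] : i%:R <= t < i.+1%:R := truncn_itv t0.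
have iN : (i < N)%N by rewrite -(@ltr_nat R); exact: le_lt_trans tN.
apply/flattenP; exists [:: i%:Z - 1; i%:Z; i%:Z + 1; i%:Z + 2].
  by apply: map_f; rewrite mem_filter (hF i t)// mem_iota.
move: xt; rewrite ltr_norml => /andP[x1 x2].
rewrite -natr1 in ti.
have y1 : x < i%:Z + 3.
  by rewrite -(ltr_int R) rmorphD/=; lra.
have y2 : i%:Z - 2 < x.
  by rewrite -(ltr_int R) rmorphB/=; lra.
rewrite !inE; lia.
Qed.

Lemma ecard_pix_ge F (r : seq nat) : uniq r ->
  (forall i, i \in r -> F i%:R) -> ((size r)%:R%:E <= @ecard R (pix F))%E.
Proof.
move=> ur hF; rewrite -(size_map Posz) -ecard_seq; last first.
  by rewrite map_inj_uniq// => a b [].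
apply: ecard_le => x /= /mapP[i ir ->] e e0; exists i%:R.
split; first exact: hF.
by rewrite subrr normr0 addr_gt0.
Qed.

End growth_exponents.

(** * Level sets of a fixed path: visited cells and upper dimension bounds *)

Section path.
Context {R : realType}.
Variable f : R -> R.
Implicit Types g e eps rho : R.

Definition level_set g : set R := [set t | 0 <= t /\ `|f t| <= t `^ g].
Local Notation E := level_set.

Definition scale_count (a : R) m : nat := count (fun i => `|f i%:R| <= a) (scale m).
Definition cell_count (a : R) n m : nat :=
  count (fun i => `|f (i * 2 ^ m)%:R| <= a) (iota 0 (2 ^ (n - m))).
(** Enumerates the nonnegative rationals by two natural numbers, for countable intersections of
    almost sure events. *)
Definition ratp (k l : nat) : R := k%:R / l.+1%:R.
(** 12 n + 20 bounds the chaining factor at levels j <= n; the extra 1 accounts for the value of the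
    path at a point of the level set. *)
Definition radius g n : R := (12 * n%:R + 21) * 2 `^ (n%:R * g).
(** The largest m with 2^(m/2) <= 2^(n g): on a cell of length 2^m the path still moves by at most a
    linear factor times the boundary. *)
Definition coarse g n := Num.truncn (n%:R * (2 * g)).

Definition oscillation_bound := exists N, forall n, (N <= n)%N ->
  forall j i t, (i < 2 ^ j)%N -> i%:R * (2 ^+ n / 2 ^+ j) <= t ->
    t < i.+1%:R * (2 ^+ n / 2 ^+ j) ->
  `|f t - f (i%:R * (2 ^+ n / 2 ^+ j))| <=
    (6 * (n + j)%:R + 20) * Num.sqrt (2 ^+ n / 2 ^+ j).
Definition cell_bound (m : nat -> nat) g e := exists N, forall n, (N <= n)%N ->
  (cell_count (radius g n) n (m n))%:R <=
  2 `^ (n%:R * e) * (1 + 4 * radius g n * root2 n / 2 ^+ m n).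
Definition often_visited g := exists2 c : R, 0 < c & forall N,
  exists2 m, (N <= m)%N & c * (2 ^ m)%:R `^ (2^-1 + g) <=
    (scale_count (2^-1 * (2 ^ m)%:R `^ g) m)%:R.

Lemma ratp_ge0 k l : 0 <= ratp k l.
Proof. by rewrite divr_ge0. Qed.

Lemma exists_ratp (x y : R) : 0 <= x -> x < y -> exists k l, x < ratp k l < y.
Proof.
move=> x0 xy; have [l hl] := exists_nat_gt (y - x)^-1.
have lp : 0 < l.+1%:R :> R by rewrite ltr0n.
pose k := (Num.truncn (x * l.+1%:R)).+1; exists k, l.
have /andP[k1 k2] : (Num.truncn (x * l.+1%:R))%:R <= x * l.+1%:R <
    (Num.truncn (x * l.+1%:R)).+1%:R.
  by apply: truncn_itv; rewrite mulr_ge0// ltW.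
apply/andP; split; first by rewrite ltr_pdivlMr.
rewrite ltr_pdivrMr//.
have : 1 < (y - x) * l.+1%:R.
  rewrite -ltr_pdivrMl ?subr_gt0// mulr1; apply: (lt_trans hl).
  by rewrite ltr_nat.
have : k%:R = (Num.truncn (x * l.+1%:R))%:R + 1 :> R by rewrite /k natr1.
by lra.
Qed.

Lemma exists_ratp1 (x : R) : 0 < x -> exists l, ratp 1 l <= x.
Proof.
move=> x0; have [l hl] := exists_nat_gt x^-1.
exists l; rewrite /ratp mul1r -[leRHS]invrK lef_pV2 ?posrE ?invr_gt0//.
by apply: (le_trans (ltW hl)); rewrite ler_nat.
Qed.

Lemma pow2_natE n : (2 : R) `^ n%:R = 2 ^+ n.
Proof. by rewrite powR_mulrn. Qed.

Lemma pow2_exp n g : ((2 : R) ^+ n) `^ g = 2 `^ (n%:R * g).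
Proof. by rewrite -pow2_natE powRrM. Qed.

Lemma pow2D (x y : R) : (2 : R) `^ (x + y) = 2 `^ x * 2 `^ y.
Proof. by rewrite powRD//; apply/implyP => _; rewrite pnatr_eq0. Qed.

Lemma pow2_le (x y : R) : x <= y -> (2 : R) `^ x <= 2 `^ y.
Proof. by apply: ler_powR; rewrite ler1n. Qed.

Lemma pow2_ge1 (x : R) : 0 <= x -> 1 <= (2 : R) `^ x.
Proof. by move=> x0; rewrite -[leLHS](powRr0 2); exact: pow2_le. Qed.

Lemma root2_pow n : root2 n = 2 `^ (n%:R * 2^-1) :> R.
Proof. by rewrite root2E natrX pow2_exp. Qed.

Lemma coarse_le g n : 0 <= g -> (coarse g n)%:R <= n%:R * (2 * g) /\
  n%:R * (2 * g) < (coarse g n)%:R + 1.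
Proof.
move=> g0; have /truncn_itv/andP[h1 h2] : 0 <= n%:R * (2 * g) :> R.
  by rewrite !mulr_ge0.
by rewrite natr1.
Qed.

(** The exponent g is real while g' will be rational: enlarging the radius passes from the
    uncountable family to the countable one. *)
Lemma level_set_cell g g' : oscillation_bound -> 0 <= g -> g <= g' ->
  exists N, forall n m i t, (N <= n)%N -> (m <= n)%N ->
    m%:R <= n%:R * (2 * g') -> (i < 2 ^ (n - m))%N ->
    E g t -> (i * 2 ^ m)%:R <= t -> t < (i.+1 * 2 ^ m)%:R ->
    `|f (i * 2 ^ m)%:R| <= radius g' n.
Proof.
move=> [N hN] g0 gg; exists N => n m i t Nn mn mg im [t0 ft] it ti.
have dE : 2 ^+ n / 2 ^+ (n - m) = 2 ^+ m :> R.
  by rewrite -{1}(subnK mn) exprD mulrAC divff ?mul1r// gt_eqF// exprn_gt0.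
have := hN n Nn (n - m)%N i t im; rewrite dE => h.
rewrite !natrM !natrX in it ti *; have {}h := h it ti.
have sq : Num.sqrt (2 ^+ m) <= 2 `^ (n%:R * g').
  rewrite -powR12_sqrt ?exprn_ge0// pow2_exp; apply: pow2_le; lra.
have tn : t <= 2 ^+ n.
  apply: (le_trans (ltW ti)); rewrite -!natrX -natrM ler_nat.
  have -> : (2 ^ n = 2 ^ (n - m) * 2 ^ m)%N by rewrite -expnD subnK.
  by rewrite leq_pmul2r// expn_gt0.
have ft' : `|f t| <= 2 `^ (n%:R * g').
  apply: (le_trans ft); apply: (@le_trans _ _ ((2 ^+ n) `^ g)).
    by apply: ge0_ler_powR; rewrite ?nnegrE ?exprn_ge0.
  by rewrite pow2_exp; apply: pow2_le; apply: ler_wpM2l.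
have n1 : (n + (n - m))%:R <= 2 * n%:R :> R by rewrite -natrM ler_nat; lia.
have n0 : 0 <= n%:R :> R by [].
set A := f (_ * _) in h *.
have h3 : `|A| <= `|f t| + `|f t - A|.
  by have := ler_normB (f t) (f t - A); rewrite opprB addrCA subrr addr0.
apply: (le_trans h3); rewrite /radius.
have h4 : (6 * (n + (n - m))%:R + 20) * Num.sqrt (2 ^+ m) <=
    (12 * n%:R + 20) * 2 `^ (n%:R * g').
  by apply: ler_pM; rewrite ?sqrtr_ge0 ?addr_ge0 ?mulr_ge0//; lra.
by lra.
Qed.

Lemma radius_ge0 g n : 0 <= radius g n.
Proof. by rewrite mulr_ge0 ?powR_ge0// addr_ge0// mulr_ge0. Qed.

Lemma cell_bound_simplified (m : nat -> nat) g e : 0 < e ->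
  (forall n, (m n)%:R <= n%:R * (2^-1 + g)) -> cell_bound m g e ->
  exists N, forall n, (N <= n)%N -> (cell_count (radius g n) n (m n))%:R <=
    2 `^ (n%:R * (2 * e) + (n%:R * (2^-1 + g) - (m n)%:R)).
Proof.
(* 85 is 4 times 21, plus 1, so that 1 + 4 (12 n + 21) <= 85 (n + 1). *)
move=> e0 hm [N1 h1]; have [N2 h2] := linear_le_exp 85 e0.
exists (maxn N1 N2) => n; rewrite geq_max => /andP[n1 n2].
apply: (le_trans (h1 n n1)).
set z : R := 2 `^ (n%:R * (2^-1 + g) - (m n)%:R).
have z1 : 1 <= z by apply: pow2_ge1; rewrite subr_ge0.
have zE : 4 * radius g n * root2 n / 2 ^+ m n = 4 * (12 * n%:R + 21) * z.
  rewrite /radius root2_pow -pow2_natE -powRN /z.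
  have -> : n%:R * (2^-1 + g) - (m n)%:R =
    n%:R * 2^-1 + n%:R * g + - (m n)%:R by ring.
  by rewrite !pow2D; ring.
have hz : 1 + 4 * radius g n * root2 n / 2 ^+ m n <= 85 * n.+1%:R * z.
  rewrite zE -natr1; have : 0 <= n%:R :> R by [].
  by set x : R := n%:R => x0; nra.
have p0 : 0 <= 2 `^ (n%:R * e) :> R by exact: powR_ge0.
apply: (le_trans (ler_wpM2l p0 hz)).
have -> : n%:R * (2 * e) + (n%:R * (2^-1 + g) - (m n)%:R) =
  n%:R * e + (n%:R * e + (n%:R * (2^-1 + g) - (m n)%:R)) by ring.
rewrite pow2D; apply: ler_wpM2l => //; rewrite pow2D -/z.
by apply: ler_wpM2r; [lra|exact: h2].
Qed.

(** With m about 2 g' n, at most 2^(n (1/2 - g')) cells are met up to small exponents, each of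
    weight about 2^(-n (1 - 2 g') rho). The product is 2^(-n kap) with kap = (1 - 2 g') (rho -
    1/2). *)
Lemma DimH_level_le g g' : oscillation_bound -> 0 <= g -> g <= g' -> g' < 2^-1 ->
  (forall l, cell_bound (coarse g') g' (ratp 1 l)) ->
  (DimH (E g) <= (2^-1)%:E)%E.
Proof.
move=> osc g0 gg g1 up; apply: DimH_le; first lra.
move=> rho hr.
pose kap := (1 - 2 * g') * (rho - 2^-1).
have kp : 0 < kap by rewrite mulr_gt0//; lra.
(* The error 2 e in the count then costs at most kap / 2 per unit of n, leaving the ratio 2^(-kap /
   2). *)
have [l hl] : exists l, ratp 1 l <= kap / 4 by apply: exists_ratp1; rewrite divr_gt0.
have e0 : 0 < ratp 1 l by rewrite divr_gt0.
have g'0 : 0 <= g' by apply: le_trans gg.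
have cl n := coarse_le n g'0.
have mb n : (coarse g' n)%:R <= n%:R * (2^-1 + g').
  apply: (le_trans (cl n).1); apply: ler_wpM2l => //; lra.
have [N1 h1] := cell_bound_simplified e0 mb (up l).
have [N2 h2] := level_set_cell osc g0 gg.
pose q : R := 2 `^ (- (kap / 2)).
have q1 : q < 1.
  rewrite /q powRN invf_lt1 ?powR_gt0// /powR gt_eqF// expR_gt1.
  by rewrite mulr_gt0 ?ln2_gt0// divr_gt0.
apply: (@geometric_bounded _ _ (maxn (maxn N1 N2) 1) 2 q) => //.
- by move=> m; exact: nu_ge0.
- exact: powR_ge0.
move=> n; rewrite !geq_max => /andP[/andP[n1 n2] n0].
have nR : 0 < n%:R :> R by rewrite ltr0n.
set m := coarse g' n.
have mn : (m < n)%N.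
  by rewrite -(@ltr_nat R); apply: (le_lt_trans (cl n).1); nra.
pose h i := `|f (i * 2 ^ m)%:R| <= radius g' n.
have sub : (n.-1 - m).+1 = (n - m)%N by lia.
apply: (le_trans (@nu_le_cells _ n m rho (E g) h mn _)).
  move=> i t; rewrite scaleP => /andP[_ im] Et it ti.
  apply: (h2 n m i t) => //; [exact: ltnW|exact: (cl n).1|].
  by rewrite -sub.
have cle : ((count h (scale (n.-1 - m)))%:R : R) <= (cell_count (radius g' n) n m)%:R.
  rewrite ler_nat /cell_count -sub /scale /index_iota -!size_filter.
  apply: uniq_leq_size; first by rewrite filter_uniq// iota_uniq.
  move=> i; rewrite !mem_filter !mem_iota /h => /andP[hi im].
  by rewrite hi; lia.
have p0 : 0 <= (2 ^+ m / 2 ^+ n) `^ rho :> R by exact: powR_ge0.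
apply: (le_trans (ler_wpM2r p0 (le_trans cle (h1 n n1)))).
have -> : (2 ^+ m / 2 ^+ n) `^ rho = 2 `^ ((m%:R - n%:R) * rho) :> R.
  by rewrite -!pow2_natE -powRN -pow2D powRrM.
have -> : 2 * q ^+ n = 2 `^ (1 + n%:R * - (kap / 2)) :> R.
  rewrite pow2D powRr1// /q -powR_mulrn ?powR_ge0// -powRrM.
  by congr (_ * _ `^ _); exact: mulrC.
rewrite -pow2D -/m; apply: pow2_le.
have := cl n; rewrite -/m => -[c1 c2].
(* Rounding 2 g' n down to m costs at most 1 in the exponent, whence the constant 2 in the geometric
   bound. *)
have key : m%:R * (rho - 1) <= n%:R * (2 * g') * (rho - 1) + 1.
  have [r1|r1] := leP 1 rho; first by nra.
  have : (n%:R * (2 * g') - m%:R) * (1 - rho) <= 1.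
    by rewrite -[leRHS]mulr1; apply: ler_pM; lra.
  by lra.
have ne : n%:R * (2 * ratp 1 l) <= n%:R * (kap / 2).
  by apply: ler_wpM2l; lra.
rewrite /kap in ne *.
by nra.
Qed.

(** The whole shell S_n is cut into 2^(n-1) unit intervals of weight 2^(-n rho), a summable bound
    for rho > 1. *)
Lemma DimH_level_le1 g : (DimH (E g) <= 1%:E)%E.
Proof.
apply: DimH_le => // rho hr.
pose q : R := 2 `^ (1 - rho).
have q1 : q < 1.
  rewrite /q -opprB powRN invf_lt1 ?powR_gt0// /powR gt_eqF// expR_gt1.
  by rewrite mulr_gt0 ?ln2_gt0// subr_gt0.
apply: (@geometric_bounded _ _ 1 1 q) => //.
- by move=> m; exact: nu_ge0.
- exact: powR_ge0.
move=> n n0; apply: (le_trans (@nu_le_cells _ n 0 rho (E g) predT n0 _)) => //.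
rewrite count_predT subn0 size_iota prednK// expr0 mul1r mul1r.
have -> : q ^+ n = 2 ^+ n * (2 ^- n) `^ rho.
  rewrite -pow2_natE -powRN -powRrM -pow2D /q -powR_mulrn ?powR_ge0// -powRrM.
  by congr (_ `^ _); ring.
apply: ler_wpM2r; first exact: powR_ge0.
by rewrite -natrX ler_nat leq_subr.
Qed.

End path.

(** * Level sets of a fixed path: mass, pixels and dimension at g = 1/2 *)

Section path_mass.
Context {R : realType}.
Variable f : R -> R.
Hypothesis cf : {within `[0, +oo[, continuous f}.
Implicit Types g e eps rho : R.
Local Notation E := (level_set f).
Local Notation mu := (@lebesgue_measure R).

Lemma measurable_level_set g : measurable (E g).
Proof.
have -> : E g = `[0, +oo[%classic `&` [set t | `|f t| <= t `^ g].
  by apply/seteqP; split => t; rewrite /level_set /= in_itv/= andbT.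
apply: measurable_fun_le => //.
- apply: measurableT_comp => //.
  exact: subspace_continuous_measurable_fun.
- by apply: measurable_funTS; exact: measurable_powR.
Qed.

Let F g n := E g `&` `[0, (2 ^+ n)]%classic.

Let measurable_F g n : measurable (F g n).
Proof. by apply: measurableI => //; exact: measurable_level_set. Qed.

Lemma level_set_mass_le g g' e : oscillation_bound f -> 0 <= g -> g <= g' ->
  0 < e -> cell_bound f (fun=> 0%N) g' e ->
  exists N, forall n, (N <= n)%N ->
    (@ecard R (pix (F g n)) <= (2 `^ (n%:R * (2^-1 + g' + 3 * e)))%:E)%E /\
    (mu (F g n) <= (2 `^ (n%:R * (2^-1 + g' + 3 * e)))%:E)%E.
Proof.
move=> osc g0 gg e0 cb.
have g'0 : 0 <= g' by exact: le_trans gg.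
have [N1 h1] : exists N, forall n, (N <= n)%N ->
    (cell_count f (radius g' n) n 0)%:R <=
    2 `^ (n%:R * (2 * e) + (n%:R * (2^-1 + g') - 0%:R)).
  apply: (@cell_bound_simplified _ f (fun=> 0%N)) => // n.
  by rewrite mulr_ge0// addr_ge0.
have [N2 h2] := level_set_cell osc g0 gg.
(* From [N3] on, n e absorbs the 4 pixels per cell and the passage from n to n + 1. *)
have [N3 h3] := exists_nat_gt ((2 + (2^-1 + g' + 2 * e)) / e).
exists (maxn (maxn N1 N2) N3) => n; rewrite !geq_max => /andP[/andP[n1 n2] n3].
(* The cells of [0, 2^(n+1)) are used because [0, 2^n] contains its right end point. *)
pose h (i : nat) := `|f (i * 2 ^ 0)%:R| <= radius g' n.+1.
have hF i t : (i < 2 ^ n.+1)%N -> F g n t -> i%:R <= t -> t < i.+1%:R -> h i.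
  move=> im [Et _] it ti; apply: (h2 n.+1 0%N i t) => //.
  - exact: leqW.
  - by rewrite !mulr_ge0.
  - by rewrite expn0 muln1.
  - by rewrite expn0 muln1.
have hc : 4 * (count h (iota 0 (2 ^ n.+1)))%:R <=
    2 `^ (n%:R * (2^-1 + g' + 3 * e)) :> R.
  have := h1 n.+1 (leqW n1); rewrite /cell_count subn0 -/h => hc.
  apply: (@le_trans _ _ (2 `^ 2%:R *
     2 `^ (n.+1%:R * (2 * e) + (n.+1%:R * (2^-1 + g') - 0%:R)))).
    by rewrite pow2_natE; apply: ler_pM => //; rewrite expr2 -natrM.
  rewrite -pow2D; apply: pow2_le; rewrite subr0 -(@natr1 R n).
  have : (2 + (2^-1 + g' + 2 * e)) <= n%:R * e.
    by rewrite -ler_pdivrMr//; apply: (le_trans (ltW h3)); rewrite ler_nat.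
  by lra.
have t2 : F g n `<=` `[0, (2 ^ n.+1)%:R[%classic.
  move=> t [_ /=]; rewrite !in_itv/= => /andP[-> t1] /=.
  apply: (le_lt_trans t1); rewrite -natrX ltr_nat.
  by rewrite ltn_exp2l.
split.
  apply: (@le_trans _ _ (4 * (count h (iota 0 (2 ^ n.+1)))%:R)%:E); last by rewrite lee_fin.
  by apply: ecard_pix_le => // i t; exact: hF.
apply: (@le_trans _ _ (count h (iota 0 (2 ^ n.+1)))%:R%:E).
  have := @lebesgue_le_count _ (F g n) h 0 (2 ^ n.+1) (measurable_F g n).
  rewrite add0n (_ : F g n `&` _ = F g n).
    by apply => i t /andP[_ im]; exact: hF.
  by apply/setIidl.
rewrite lee_fin; apply: le_trans hc.
by have : 0 <= (count h (iota 0 (2 ^ n.+1)))%:R :> R by []; lra.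
Qed.

Lemma scale_iota m : scale m = iota (2 ^ m) (2 ^ m).
Proof. by rewrite /scale /index_iota expnS mul2n -addnn addnK. Qed.

(** At a visited integer the path is below half the boundary, and over a time [del] of order 2^(-n
    e) it moves by at most 1/2. Each visit thus yields length [del] in the level set, at a cost of
    about n e in the exponent. *)
Lemma level_set_mass_ge g g0 e : oscillation_bound f -> 0 <= g0 -> g0 <= g ->
  g0 <= 2^-1 -> 0 < e -> e <= 1 -> often_visited f g0 ->
  forall N, exists2 n, (N <= n)%N &
    ((2 `^ (n%:R * (2^-1 + g0 - 2 * e)))%:E <= @ecard R (pix (F g n)))%E /\
    ((2 `^ (n%:R * (2^-1 + g0 - 2 * e)))%:E <= mu (F g n))%E.
Proof.
move=> [N1 osc] g00 gg g01 e0 e1 [c cp vis] N.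
(* Since r <= n + 1, twice 6 (2 n + r) + 20 is at most 36 n + 52 <= 52 (n + 1). *)
have [N2 h2] := @linear_le_exp R 52 (e / 2) (divr_gt0 e0 (ltr0Sn _ _)).
(* The 4 pays for rounding r up and for replacing n by m = n - 1, a factor at most 2 each. *)
have [N3 h3] := linear_le_exp (4 / c) e0.
have [m Nm hm] := vis (maxn (maxn N N1) (maxn N2 N3)).
move: Nm; rewrite !geq_max => /andP[/andP[Nm N1m] /andP[N2m N3m]].
pose n := m.+1; exists n; first exact: leqW.
pose V i := `|f i%:R| <= 2^-1 * (2 ^ m)%:R `^ g0.
have nR : 0 <= n%:R * e by rewrite mulr_ge0// ltW.
pose r := (Num.truncn (n%:R * e)).+1.
have /andP[r1 r2] : (Num.truncn (n%:R * e))%:R <= n%:R * e < r%:R := truncn_itv nR.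
have r3 : r%:R <= n%:R * e + 1 by rewrite /r -(@natr1 R (Num.truncn _)) lerD2r.
have rn : r%:R <= n%:R + 1 :> R.
  by apply: (le_trans r3); rewrite lerD2r ler_piMr.
pose del : R := 2 ^+ n / 2 ^+ (n + r).
have delE : del = 2 ^- r.
  by rewrite /del exprD invfM mulrA divff ?mul1r// gt_eqF// exprn_gt0.
have del0 : 0 < del by rewrite delE invr_gt0 exprn_gt0.
have del1 : del <= 1 by rewrite delE invf_le1 ?exprn_gt0// exprn_ege1// ler1n.
have m1 : 1 <= (2 ^ m)%:R :> R by rewrite ler1n expn_gt0.
have small : (6 * (n + (n + r))%:R + 20) * Num.sqrt del <= 2^-1.
  have sd : Num.sqrt del <= (2 `^ (n%:R * (e / 2)))^-1.
    rewrite delE sqrtrV ?exprn_ge0// lef_pV2 ?posrE ?powR_gt0 ?sqrtr_gt0 ?exprn_gt0//.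
    by rewrite -powR12_sqrt ?exprn_ge0// pow2_exp; apply: pow2_le; lra.
  have p0 : 0 < 2 `^ (n%:R * (e / 2)) :> R by rewrite powR_gt0.
  apply: (@le_trans _ _ ((6 * (n + (n + r))%:R + 20) * (2 `^ (n%:R * (e / 2)))^-1)).
    by apply: ler_wpM2l => //; rewrite addr_ge0// mulr_ge0.
  rewrite ler_pdivrMr//.
  have := h2 n (leqW N2m); rewrite -(@natr1 R n) !natrD.
  by have : 0 <= n%:R :> R by []; lra.
have near i t : i \in scale m -> V i -> i%:R <= t -> t < i%:R + del -> F g n t.
  rewrite scaleP => /andP[im1 im2] Vi it ti.
  have ir : (i * 2 ^ r < 2 ^ (n + r))%N.
    by rewrite expnD ltn_pmul2r// expn_gt0.
  have iE : (i * 2 ^ r)%:R * del = i%:R.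
    by rewrite delE natrM natrX mulfK// gt_eqF// exprn_gt0.
  have iE' : (i * 2 ^ r).+1%:R * del = i%:R + del.
    by rewrite -(@natr1 R (i * 2 ^ r)) mulrDl iE mul1r.
  have := osc n (leqW N1m) (n + r)%N _ t ir; rewrite -/del iE iE' => /(_ it ti) h.
  have t1 : 1 <= t.
    by apply: (le_trans m1); apply: le_trans it; rewrite ler_nat.
  have mt : (2 ^ m)%:R <= t by apply: le_trans it; rewrite ler_nat.
  have ft : `|f t| <= t `^ g.
    have h4 : `|f t| <= `|f i%:R| + `|f t - f i%:R|.
      by have := ler_normD (f i%:R) (f t - f i%:R); rewrite addrC subrK.
    have p1 : 1 <= (2 ^ m)%:R `^ g0 :> R.
      by rewrite -[leLHS](powRr0 ((2 ^ m)%:R : R)); exact: ler_powR.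
    apply: (@le_trans _ _ ((2 ^ m)%:R `^ g0)).
      by move: Vi; rewrite /V => Vi; lra.
    apply: (@le_trans _ _ (t `^ g0)); last exact: ler_powR.
    by apply: ge0_ler_powR => //; rewrite nnegrE// (le_trans ler01).
  split; first by split => //; apply: le_trans t1.
  rewrite /= in_itv/= (le_trans ler01 t1)/=.
  apply: (le_trans (ltW ti)); apply: (@le_trans _ _ (i%:R + 1)).
    by rewrite lerD2l.
  by rewrite natr1 -natrX ler_nat.
pose C := (count V (scale m))%:R : R.
have key : 2 `^ (n%:R * (2^-1 + g0 - 2 * e)) <= del * C.
  have -> : del = 2 `^ (- r%:R) by rewrite delE powRN pow2_natE.
  apply: (@le_trans _ _ (2 `^ (- (n%:R * e + 1)) *
     (c * 2 `^ (n%:R * (2^-1 + g0) - 1)))); last first.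
    apply: ler_pM; rewrite ?powR_ge0//.
    - by rewrite mulr_ge0 ?powR_ge0// ltW.
    - by apply: pow2_le; rewrite lerN2.
    apply: le_trans hm; apply: ler_wpM2l; first exact: ltW.
    rewrite natrX pow2_exp; apply: pow2_le; rewrite /n -(@natr1 R m); lra.
  have hc : 4 <= c * 2 `^ (n%:R * e).
    rewrite -ler_pdivrMl// mulrC; apply: le_trans (h3 n (leqW N3m)).
    by rewrite ler_peMr ?divr_ge0 ?(ltW cp)// ler1n.
  have -> : 2 `^ (- (n%:R * e + 1)) * (c * 2 `^ (n%:R * (2^-1 + g0) - 1)) =
     (c * 2 `^ (n%:R * e)) * 2 `^ (n%:R * (2^-1 + g0 - 2 * e) - 2%:R).
    have -> : - (n%:R * e + 1) = n%:R * e + (- (n%:R * (2 * e)) - 1) by ring.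
    have -> : n%:R * (2^-1 + g0 - 2 * e) - 2%:R =
       (- (n%:R * (2 * e)) - 1) + (n%:R * (2^-1 + g0) - 1) by ring.
    by rewrite !(pow2D (n%:R * e)) !(pow2D (- (n%:R * (2 * e)) - 1)); ring.
  set u := n%:R * (2^-1 + g0 - 2 * e).
  have -> : 2 `^ u = 2 `^ 2%:R * 2 `^ (u - 2%:R) :> R.
    by rewrite -pow2D; congr (_ `^ _); ring.
  apply: ler_wpM2r; first exact: powR_ge0.
  by rewrite pow2_natE expr2 -natrM.
split.
  apply: (@le_trans _ _ C%:E).
    rewrite lee_fin; apply: (le_trans key).
    by rewrite ler_piMl// /C.
  rewrite /C -size_filter; apply: ecard_pix_ge.
    by rewrite filter_uniq// iota_uniq.
  move=> i; rewrite mem_filter => /andP[Vi im].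
  by apply: (near i) => //; rewrite ltrDl.
apply: (@le_trans _ _ (del * C)%:E); first by rewrite lee_fin.
rewrite /C scale_iota.
apply: (@le_trans _ _ (mu (F g n `&` `[(2 ^ m)%:R, (2 ^ m + 2 ^ m)%:R[))).
  apply: lebesgue_ge_count => // i im Vi t /=; rewrite in_itv/= => /andP[it ti].
  by apply: (near i) => //; rewrite scaleP expnS mul2n -addnn.
apply: le_measure; rewrite ?inE; [|exact: measurable_F|exact: subIsetl].
by apply: measurableI => //; exact: measurable_F.
Qed.

Lemma DimUM_le g : oscillation_bound f -> 0 <= g ->
  (forall k l l', cell_bound f (fun=> 0%N) (ratp k l) (ratp 1 l')) ->
  (DimUM (E g) <= (2^-1 + g)%:E)%E /\ (Denlog (E g) <= (2^-1 + g)%:E)%E.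
Proof.
move=> osc g0 cb.
have main (eps : R) : 0 < eps -> exists N, forall n, (N <= n)%N -> (0 < n)%N /\
    (@ecard R (pix (F g n)) <= (2 `^ (n%:R * (2^-1 + g + eps)))%:E)%E /\
    (mu (F g n) <= (2 `^ (n%:R * (2^-1 + g + eps)))%:E)%E.
  move=> eps0.
  have [|k [l /andP[gk kg]]] := @exists_ratp R g (g + eps / 4) g0; first lra.
  have [|l' hl] := @exists_ratp1 R (eps / 4); first lra.
  have e0 : 0 < ratp 1 l' :> R by rewrite divr_gt0.
  have [N hN] := level_set_mass_le osc g0 (ltW gk) e0 (cb k l l').
  exists (maxn N 1) => n; rewrite geq_max => /andP[Nn n0]; split => //.
  have pe : (2 `^ (n%:R * (2^-1 + ratp k l + 3 * ratp 1 l')) <=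
     2 `^ (n%:R * (2^-1 + g + eps)) :> R).
    by apply: pow2_le; apply: ler_wpM2l => //; lra.
  by have [a b] := hN n Nn; split; [apply: (le_trans a)|apply: (le_trans b)];
    rewrite lee_fin.
by split; apply: limn_esup_le_near => eps eps0; have [N hN] := main eps eps0;
  exists N => n Nn; have [n0 [a b]] := hN n Nn; apply: log2e_le => //;
  exact: ecard_ge0.
Qed.

Lemma DimUM_ge g : oscillation_bound f -> 0 <= g -> g <= 2^-1 ->
  (forall k l, ratp k l <= 2^-1 :> R -> often_visited f (ratp k l)) ->
  ((2^-1 + g)%:E <= DimUM (E g))%E /\ ((2^-1 + g)%:E <= Denlog (E g))%E.
Proof.
move=> osc g0 g1 vis.
have main (eps : R) N : 0 < eps -> exists2 n, (N <= n)%N & (0 < n)%N /\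
    ((2 `^ (n%:R * (2^-1 + g - eps)))%:E <= @ecard R (pix (F g n)))%E /\
    ((2 `^ (n%:R * (2^-1 + g - eps)))%:E <= mu (F g n))%E.
  move=> eps0.
  have [k [l [kl1 kl2]]] : exists k l, ratp k l <= g /\ g - eps / 4 <= ratp k l.
    (* [exists_ratp] needs a nonnegative lower end; for g <= eps / 4 the exponent 0 serves. *)
    have [h|h] := leP g (eps / 4).
      by exists 0%N, 0%N; rewrite /ratp mul0r; split => //; lra.
    have [||k [l /andP[a b]]] := @exists_ratp R (g - eps / 4) g; [lra|lra|].
    by exists k, l; split; exact: ltW.
  pose e : R := Num.min 1 (eps / 4).
  have e0 : 0 < e by rewrite lt_min ltr01 divr_gt0.
  have e1 : e <= 1 by rewrite ge_min lexx.
  have e2 : e <= eps / 4 by rewrite ge_min lexx orbT.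
  have kl3 : ratp k l <= 2^-1 :> R by exact: le_trans g1.
  have [n] := level_set_mass_ge osc (ratp_ge0 k l) kl1 kl3 e0 e1
    (vis k l kl3) (maxn N 1).
  rewrite geq_max => /andP[Nn n0] [a b]; exists n => //; split => //.
  have pe : (2 `^ (n%:R * (2^-1 + g - eps)) <=
     2 `^ (n%:R * (2^-1 + ratp k l - 2 * e)) :> R).
    by apply: pow2_le; apply: ler_wpM2l => //; lra.
  by split; [apply: le_trans a|apply: le_trans b]; rewrite lee_fin.
by split; apply: limn_esup_ge_often => eps N eps0;
  have [n Nn [n0 [a b]]] := main eps N eps0; exists n => //; exact: log2e_ge.
Qed.

(** A visited integer is a point of the level set in S_(m+1), hence of some covering interval; this
    feeds both lemmas that compare visits with a cover. *)
Lemma scale_count_cover g a m Q : 0 <= g -> (forall i, i \in scale m ->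
    `|f i%:R| <= a -> `|f i%:R| <= i%:R `^ g) -> covers m.+1 (E g) Q ->
  forall i, i \in scale m -> `|f i%:R| <= a ->
    exists2 q, q \in Q & (q.1 <= i < q.2)%N.
Proof.
move=> g0 ha cQ i im Vi.
have [] := cQ i%:R.
  split; first by split => //; exact: ha.
  move: im; rewrite scaleP => /andP[i1 i2]; rewrite /Sn /= natrXE.
  by rewrite ler_nat -natrX ltr_nat.
move=> q /= qQ; rewrite in_itv/= ler_nat ltr_nat => iq.
by exists q.
Qed.

(** At infinitely many scales there are at least c 2^m visits, which forces [nu m.+1] above c / 2
    for rho < 1, so the terms do not tend to 0. *)
Lemma DimH_half_ge : often_visited f 2^-1 -> (1%:E <= DimH (E 2^-1))%E.
Proof.
move=> [c cp vis]; apply: DimH_ge => rho r0 r1 tail.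
have [N hN] := tail (c / 4) (divr_gt0 cp (ltr0Sn _ _)).
have [m Nm hm] := vis N.
have := hN m.+1; rewrite big_nat_recr//=; apply/negP; rewrite -ltNge.
have h0 : 0 <= \sum_(N <= i < m) nu i.+1 rho (E 2^-1).
  by apply: sumr_ge0 => i _; exact: nu_ge0.
suff : c / 2 <= nu m.+1 rho (E 2^-1) by lra.
apply: nu_ge => // Q aQ cQ.
pose V i := `|f i%:R| <= 2^-1 * (2 ^ m)%:R `^ 2^-1.
have := @visits_le_length R m rho V Q (ltW r1) aQ.
have hV i : i \in scale m -> V i -> `|f i%:R| <= i%:R `^ 2^-1.
  rewrite scaleP => /andP[i1 _] /le_trans; apply.
  apply: (@le_trans _ _ ((2 ^ m)%:R `^ 2^-1)).
    by have := powR_ge0 ((2 ^ m)%:R : R) 2^-1; lra.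
  by apply: ge0_ler_powR; rewrite ?nnegrE// ler_nat.
have half0 : 0 <= 2^-1 :> R by [].
move=> /(_ (scale_count_cover half0 hV cQ)); apply: le_trans.
rewrite -natr_sum.
have -> : (\sum_(i <- scale m) V i = count V (scale m))%N.
  by rewrite -sum1_count [RHS]big_mkcond; apply: eq_bigr => i _; case: (V i).
rewrite ler_pdivlMr ?exprn_gt0//; apply: le_trans hm.
have -> : 2^-1 + 2^-1 = 1 :> R by lra.
by rewrite powRr1// natrX exprS; lra.
Qed.

End path_mass.

(** * Countably many almost sure events and the conclusion *)

Section almost_sure_path.
Context {R : realType} {d : measure_display} {T : measurableType d}.
Variables (P : probability T R) (B : R -> T -> R).
Hypothesis BM : brownian_motion P B.

Section fixed_path.
Variable w : T.
Hypothesis B0 : B 0 w = 0.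
Let f t := B t w.

Lemma indic_absW (a t : R) : \1_(absW B a t) w = (`|f t| <= a)%R%:R :> R.
Proof.
rewrite indicE; congr (_%:R); congr nat_of_bool.
have e : absW B a t w = (`|f t| <= a) :> Prop.
  by rewrite /absW/= /shiftedBM B0 subr0.
by apply/idP/idP => [/set_mem|h]; [rewrite e|apply/mem_set; rewrite e].
Qed.

Lemma visit_countE a m : visit_count B a m w = (scale_count f a m)%:R.
Proof.
rewrite /visit_count /scale_count -sum1_count natr_sum [RHS]big_mkcond/=.
by apply: eq_bigr => i _; rewrite indic_absW; case: ifP.
Qed.

Lemma grid_countE a n m : grid_count B a n m w = (cell_count f a n m)%:R.
Proof.
rewrite /grid_count /wsum /cell_count -sum1_count natr_sum [RHS]big_mkcond/=.
by apply: eq_bigr => i _; rewrite indic_absW mul1r; case: ifP.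
Qed.

Lemma visit_energyE a rho m : visit_energy B a rho m w =
  \sum_(i <- scale m) \sum_(j <- scale m) riesz rho m (ndist i j) *
    ((`|f i%:R| <= a) && (`|f j%:R| <= a))%R%:R.
Proof.
apply: eq_bigr => i _; apply: eq_bigr => j _.
by rewrite indicI/= !indic_absW -natrM mulnb.
Qed.

(** The divergence of energies is available at rational exponents, so one is taken strictly between
    rho and 1/2. Visits of width a <= 1 lie in the level set because i^g >= 1. *)
Lemma DimH_level_ge g : 0 <= g ->
  (forall k l, ratp k l < 2^-1 :> R ->
    ~ exists2 nu : nat -> R, (forall m, 0 <= nu m) &
    (forall m a lam, 0 < a -> a <= 1 -> 0 < lam ->
      visit_count B a m w <= lam / 2 * nu m +
        visit_energy B a (ratp k l) m w / (2 * lam)) /\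
    exists N, forall k, \sum_(N <= m < k) nu m <= 1) ->
  ((2^-1)%:E <= DimH (level_set f g))%E.
Proof.
move=> g0 H; apply: DimH_ge => rho r0 r1 tail.
have [k [l /andP[r2 r3]]] := exists_ratp r0 r1.
apply: (H k l r3); exists (fun m => nu m.+1 rho (level_set f g)).
  by move=> m; exact: nu_ge0.
split; last exact: tail.
move=> m a lam a0 a1 lam0; rewrite visit_countE visit_energyE.
set Z := _ / (2 * lam); set c := (scale_count f a m)%:R.
have l2 : 0 < lam / 2 by rewrite divr_gt0.
(* The comparison is affine in the cover sum with positive slope lam / 2; solved for the cover sum,
   it passes to the infimum. *)
suff : (c - Z) / (lam / 2) <= nu m.+1 rho (level_set f g).
  by rewrite ler_pdivrMr//; lra.
apply: nu_ge => // Q aQ cQ.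
have ha i : i \in scale m -> `|f i%:R| <= a -> `|f i%:R| <= i%:R `^ g.
  move=> im /le_trans; apply; apply: (le_trans a1).
  have i1 : 1 <= i%:R :> R by rewrite ler1n (scale_gt0 im).
  by rewrite -[leLHS](powRr0 (i%:R : R)); exact: ler_powR.
have := visits_le_energy r0 (ltW r2) lam0 aQ (scale_count_cover g0 ha cQ).
have -> : \sum_(i <- scale m) (`|f i%:R| <= a)%R%:R = c.
  rewrite /c /scale_count -sum1_count natr_sum [RHS]big_mkcond/=.
  by apply: eq_bigr => i _; case: ifP.
by rewrite -/Z ler_pdivrMr//; lra.
Qed.

End fixed_path.

Lemma ae_cell_bound (m : nat -> nat) g e : (forall n, (m n <= n)%N) -> 0 < e ->
  {ae P, forall w, B 0 w = 0 -> cell_bound (fun t => B t w) m g e}.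
Proof.
move=> mn e0.
have := ae_grid_count_le BM mn (radius_ge0 g) e0.
apply: filterS => w [N hN] B0; exists N => n Nn.
by have := hN n Nn; rewrite grid_countE.
Qed.

Lemma coarse_leq (g : R) n : 0 <= g -> g < 2^-1 -> (coarse g n <= n)%N.
Proof.
move=> g0 g1; rewrite -(@ler_nat R); apply: (le_trans (coarse_le n g0).1).
by rewrite ler_piMr//; lra.
Qed.

Lemma ae_often_visited g : 0 <= g -> g <= 2^-1 ->
  {ae P, forall w, B 0 w = 0 -> often_visited (fun t => B t w) g}.
Proof.
move=> g0 g1; have := ae_visits_io BM g0 g1.
apply: filterS => w [c c0 hc] B0; exists c => // N.
by have [m Nm hm] := hc N; exists m => //; rewrite -visit_countE.
Qed.

Lemma ae_and (A A' : T -> Prop) : {ae P, forall w, A w} ->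
  {ae P, forall w, A' w} -> {ae P, forall w, A w /\ A' w}.
Proof. by apply: filterS2 => w; split. Qed.

(** Moves the restriction on the exponent inside the event, so that intersections run over all [k]
    and [l]. *)
Lemma ae_imply (Q : Prop) (A : T -> Prop) : (Q -> {ae P, forall w, A w}) ->
  {ae P, forall w, Q -> A w}.
Proof.
move=> h; have [q|nq] := pselect Q; first by apply: filterS (h q).
by apply: aeW => w /nq.
Qed.

Lemma ae_path_properties : {ae P, forall w,
  [/\ B 0 w = 0, {within `[0, +oo[, continuous (fun t => B t w)},
      oscillation_bound (fun t => B t w) &
  [/\ forall k l l', cell_bound (fun t => B t w) (fun=> 0%N) (ratp k l) (ratp 1 l'),
      forall k l l', ratp k l < 2^-1 :> R ->
        cell_bound (fun t => B t w) (coarse (ratp k l : R)) (ratp k l) (ratp 1 l'),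
      forall k l, ratp k l <= 2^-1 :> R ->
        often_visited (fun t => B t w) (ratp k l) &
      forall k l, ratp k l < 2^-1 :> R ->
        ~ exists2 nu : nat -> R, (forall m, 0 <= nu m) &
        (forall m a lam, 0 < a -> a <= 1 -> 0 < lam ->
          visit_count B a m w <= lam / 2 * nu m +
            visit_energy B a (ratp k l) m w / (2 * lam)) /\
        exists N, forall k, \sum_(N <= m < k) nu m <= 1]]}.
Proof.
have r0 k l := @ratp_ge0 R k l.
have r1 l : 0 < ratp 1 l :> R by rewrite divr_gt0.
have H1 : {ae P, forall w k l l', B 0 w = 0 ->
    cell_bound (fun t => B t w) (fun=> 0%N) (ratp k l) (ratp 1 l')}.
  apply: ae_foralln => k; apply: ae_foralln => l; apply: ae_foralln => l'.
  exact: ae_cell_bound.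
have H2 : {ae P, forall w k l l', ratp k l < 2^-1 :> R -> B 0 w = 0 ->
    cell_bound (fun t => B t w) (coarse (ratp k l : R)) (ratp k l) (ratp 1 l')}.
  apply: ae_foralln => k; apply: ae_foralln => l; apply: ae_foralln => l'.
  by apply: ae_imply => h; apply: ae_cell_bound => // n; exact: coarse_leq.
have H3 : {ae P, forall w k l, ratp k l <= 2^-1 :> R -> B 0 w = 0 ->
    often_visited (fun t => B t w) (ratp k l)}.
  apply: ae_foralln => k; apply: ae_foralln => l.
  by apply: ae_imply => h; exact: ae_often_visited.
have H4 : {ae P, forall w k l, ratp k l < 2^-1 :> R ->
        ~ exists2 nu : nat -> R, (forall m, 0 <= nu m) &
        (forall m a lam, 0 < a -> a <= 1 -> 0 < lam ->
          visit_count B a m w <= lam / 2 * nu m +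
            visit_energy B a (ratp k l) m w / (2 * lam)) /\
        exists N, forall k, \sum_(N <= m < k) nu m <= 1}.
  apply: ae_foralln => k; apply: ae_foralln => l.
  by apply: ae_imply => h; exact: (ae_energy_diverges BM).
have [_ H0 _ _] := BM.
have H5 := ae_oscillation BM.
have H01 := ae_and H0 H5; have H12 := ae_and H1 H2; have H34 := ae_and H3 H4.
apply: filterS3 H01 H12 H34 => w [[B0 cf] osc] [h1 h2] [h3 h4].
split => //; split => //.
- by move=> k l l'; exact: h1.
- by move=> k l l' h; exact: h2.
- by move=> k l h; exact: h3.
Qed.

End almost_sure_path.
Theorem theorem1 (R : realType) (d : measure_display) (T : measurableType d)
    (P : probability T R) (B : R -> T -> R) :
  brownian_motion P B ->
  {ae P, forall w, forall g : R, 0 <= g -> g <= 2^-1 ->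
     [/\ DimH (Egam B w g) = (if g < 2^-1 then 2^-1 else 1)%:E,
         DimUM (Egam B w g) = (2^-1 + g)%:E &
         Denlog (Egam B w g) = (2^-1 + g)%:E]}.
Proof.
move=> BM; apply: filterS (ae_path_properties BM) => w.
move=> [B0 cf osc [cb0 cbc vis en]] g g0 g1.
have [um1 den1] := DimUM_le cf osc g0 cb0.
have [um2 den2] := DimUM_ge cf osc g0 g1 vis.
have dim0 := DimH_level_ge B0 g0 en.
have EE : Egam B w g = level_set (fun t => B t w) g by [].
rewrite EE; split; last 2 first.
- by apply/eqP; rewrite eq_le um1 um2.
- by apply/eqP; rewrite eq_le den1 den2.
apply/eqP; rewrite eq_le; case: ifPn => [lt|nlt]; apply/andP; split.
(* The rational exponent must stay strictly below 1/2, so that cells of length about 2^(2 n g') are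
   shorter than the shell. *)
- have [k [l /andP[gk kl]]] := exists_ratp g0 lt.
  by apply: (DimH_level_le osc g0 (ltW gk) kl) => l'; exact: cbc.
- exact: dim0.
- exact: DimH_level_le1.
- have -> : g = 2^-1 by apply/eqP; rewrite eq_le g1 leNgt nlt.
  (* [ratp] divides by [l.+1], so 1/2 is itself one of the enumerated exponents. *)
  have half : ratp 1 1 = 2^-1 :> R by rewrite /ratp mul1r.
  by apply: DimH_half_ge; rewrite -half; apply: vis; rewrite half.
Qed.
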